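(* Suppose that the de Donder--Weyl equations $$\dot u^i=\frac{\partial H}{\partial p_i},\qquad \partial_\mu u^i=\frac{\partial H}{\partial\sigma_i^\mu},\qquad -(\dot p_i+\partial_\mu\sigma_i^\mu)=\frac{\partial H}{\partial u^i}$$ for a Hamiltonian $H=H(x,u,p,\sigma)$ not depending on $t$ can be written as $\dot y=f(y)$ with $y=(u,p)$, where $\sigma$ is an implicit function of the other variables. Let $\xi=(v,r)$ and $\eta=(v',r')$, with $\tau=\sigma'(y)\xi$ and $\tau'=\sigma'(y)\eta$, and define the augmented vector field $$g(y,\xi,\eta,z)=\Bigl(f(y),\,f'(y)\xi,\,f'(y)\eta,\,-\partial_\mu\bigl(\omega^\mu\bigl((v,r,\tau),(v',r',\tau')\bigr)\bigr)\Bigr).$$ If $\Phi$ is an affine equivariant numerical integrator preserving quadratic invariants, then $$\Phi_g\Bigl(y_0,\xi_0,\eta_0,\omega^0\bigl((v_0,r_0,\tau_0),(v_0',r_0',\tau_0')\bigr)\Bigr)=\Bigl(y_1,\xi_1,\eta_1,\omega^0\bigl((v_1,r_1,\tau_1),(v_1',r_1',\tau_1')\bigr)\Bigr),$$ where $y_1=\Phi_f(y_0)$, $\xi_1=\Phi_f'(y_0)\xi_0$, and $\eta_1=\Phi_f'(y_0)\eta_0$.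
   Context: Setting: $\Omega\subset\mathbb{R}^m$ is a spatial domain with coordinates $x=(x^1,\dots,x^m)$; the unknown fields are $u=u^i(t,x)\in\mathbb{R}^n$, $p=p_i(t,x)\in\mathbb{R}^n$, $\sigma=\sigma_i^\mu(t,x)\in\mathbb{R}^{mn}$, with $i=1,\dots,n$, $\mu=1,\dots,m$; repeated indices are summed. The second de Donder--Weyl equation is assumed to define $\sigma$ as a function of $x,u,p,\operatorname{grad}u$ (locally the case when the $mn\times mn$ matrix $\partial^2H/\partial\sigma_i^\mu\partial\sigma_j^\nu$ is nondegenerate); substituting it into the other two equations gives $\dot y=f(y)$ for $y=(u,p)$ in a Banach space $Y$ of functions on $\Omega$. Write $\sigma=\sigma(y)$ and let $\sigma'(y)$ be its derivative. A variation $\eta=(v,r)$ of $y$ evolves by $\dot\eta=f'(y)\eta$. Subscripts $0,1$ on $(v,r),(v',r')$ denote the components of $\xi_0,\xi_1$ and $\eta_0,\eta_1$, and $\tau_k=\sigma'(y_k)\xi_k$, $\tau_k'=\sigma'(y_k)\eta_k$. Canonical 2-forms on $\mathbb{R}^n\times\mathbb{R}^n\times\mathbb{R}^{mn}\ni(u,p,\sigma)$: $\omega^0=\mathrm{d}u^i\wedge\mathrm{d}p_i$ and $\omega^\mu=\mathrm{d}u^i\wedge\mathrm{d}\sigma_i^\mu$; explicitly $\omega^0((v,r,\tau),(v',r',\tau'))=v^ir_i'-v'^ir_i$ and $\omega^\mu((v,r,\tau),(v',r',\tau'))=v^i\tau_i'^\mu-v'^i\tau_i^\mu$ (evaluated pointwise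 on $\Omega$). The variable $z$ lies in an appropriate Banach space $Z$ of densities on $\Omega$, in which $\omega^0$ takes its values as a continuous bilinear function of $(\xi,\eta)$. (Along variations of solutions, the multisymplectic conservation law $\partial_t\omega^0=-\partial_\mu\omega^\mu$ holds.) Numerical integrators: $\mathfrak{X}(Y)$ denotes vector fields on a Banach space $Y$, viewed as maps $Y\to Y$. A numerical integrator is a collection of maps $\Phi=\{\Phi_f\colon Y\to Y\mid f\in\mathfrak{X}(Y),\ Y\text{ a Banach space}\}$ ($\Phi_f$ is one step with unit time step). Regularity is left implicit: vector fields, and the dependence of $\Phi_f(y)$ on its data, are taken regular enough that all derivatives written make sense. For affine $A\colon Y\to U$ with linear part $A'$, vector fields $f\in\mathfrak{X}(Y)$, $g\in\mathfrak{X}(U)$ are $A$-related if $A'\circ f=g\circ A$; $\Phi$ is affine equivariant if $A\circ\Phi_f=\Phi_g\circ A$ for all $A$-related $f,g$, all affine $A$, and all Banach spaces. $\Phi$ preserves quadratic invariants if $F\circ\Phi_f=F$ for all Banach spaces $Y,Z$, all $f\in\mathfrak{X}(Y)$, and all quadratic maps $F\colon Y\to Z$ (polynomial of degree at most 2) with $F'(y)f(y)=0$ for all $y$. *)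

(* Defs.v *)
From HB Require Import structures.
From mathcomp Require Import all_boot all_order all_algebra.
From mathcomp Require Import sesquilinear.
From mathcomp Require Import boolp classical_sets reals topology normedtype derive.

Set Implicit Arguments.
Unset Strict Implicit.
Unset Printing Implicit Defensive.

Import Order.TTheory GRing.Theory Num.Theory.
Import numFieldNormedType.Exports.

Local Open Scope classical_set_scope.
Local Open Scope ring_scope.

(* The library lacks completeness of products, needed for Y * Z to be again a
   Banach space. *)
Section ProductComplete.
Variables (R : realType) (U V : completeNormedModType R).

HB.instance Definition _ := Pointed.on (U * V)%type.

Lemma prod_complete (F : set_system (U * V)) :
  ProperFilter F -> cauchy F -> cvg F.
Proof.
move=> FF Fc.
have c1 : cvg (fst @ F).
  apply: cauchy_cvg => A /= entA.
  rewrite near_simpl -near2E near_map2; apply: Fc.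
  by apply: filterS (prod_entP entA (@entourageT V)) => z [].
have c2 : cvg (snd @ F).
  apply: cauchy_cvg => A /= entA.
  rewrite near_simpl -near2E near_map2; apply: Fc.
  by apply: filterS (prod_entP (@entourageT U) entA) => z [].
apply/cvg_ex; exists (lim (fst @ F), lim (snd @ F)) => A [[A1 A2] /= [h1 h2] sA].
have {}h1 : F (fst @^-1` A1) by exact: c1.
have {}h2 : F (snd @^-1` A2) by exact: c2.
by apply: filterS (filterI h1 h2) => z [/= ? ?]; exact: sA.
Qed.

HB.instance Definition _ :=
  Uniform_isComplete.Build (U * V)%type prod_complete.
End ProductComplete.

Section Smoothness.
Variable R : realType.

(* C^k on the open set U, through the iterated tangent maps
   (y, h) |-> f'(y) h.  For maps between finite-dimensional spaces this is the
   usual C^k, and for k = oo it is the usual (Frechet) C^oo; for finite k in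
   infinite dimension it may be weaker than continuity of the k-th derivative
   in operator norm, but it is used there only for all k at once. *)
Fixpoint Ck (k : nat) (V W : normedModType R) (U : set V) (f : V -> W) : Prop :=
  if k is k'.+1 then
    (forall y, U y -> differentiable f y) /\
    @Ck k' (V * V)%type W (U `*` setT) (fun z => 'd f (z.1) (z.2))
  else forall y, U y -> {for y, continuous f}.

Definition smooth (V W : normedModType R) (f : V -> W) : Prop :=
  forall k, Ck k setT f.

End Smoothness.

Section Integrators.
Variable R : realType.

(* Vector fields are the smooth maps Y -> Y: the values of an integrator at
   non-smooth maps are junk, and every property below ignores them. *)
Definition integrator := forall Y : completeNormedModType R, (Y -> Y) -> Y -> Y.

Implicit Type Phi : integrator.

Definition regular_integrator Phi : Prop :=
  forall (Y : completeNormedModType R) (f : Y -> Y),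
    smooth f -> forall y, differentiable (Phi Y f) y.

(* The affine map is A = fun y => L y + b, with linear part A' = L. *)
Definition affine_equivariant Phi : Prop :=
  forall (Y U : completeNormedModType R) (L : {linear Y -> U}) (b : U),
    continuous L ->
    forall (f : Y -> Y) (g : U -> U), smooth f -> smooth g ->
      (forall y, L (f y) = g (L y + b)) ->
      forall y, L (Phi Y f y) + b = Phi U g (L y + b).

Definition quadratic_map (Y Z : completeNormedModType R) (F : Y -> Z) : Prop :=
  exists (c : Z) (L : {linear Y -> Z}) (Q : {bilinear Y -> Y -> Z}),
    [/\ continuous L, continuous (fun p : Y * Y => Q p.1 p.2)
      & forall y, F y = c + L y + Q y y].

Definition preserves_quadratic_invariants Phi : Prop :=
  forall (Y Z : completeNormedModType R) (f : Y -> Y) (F : Y -> Z),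
    smooth f -> quadratic_map F -> (forall y, 'd F y (f y) = 0) ->
    forall y, F (Phi Y f y) = F y.

End Integrators.

(* (u, p, sigma), with sigma_i^mu stored in row i and column mu *)
Notation phase R m n := ('rV[R]_n * 'rV[R]_n * 'M[R]_(n, m))%type.

Section DeDonderWeyl.
Variables (R : realType) (m n : nat).

Definition omega0 (a b : phase R m n) : R :=
  \sum_(i < n) (a.1.1 0 i * b.1.2 0 i - b.1.1 0 i * a.1.2 0 i).

Definition omega (mu : 'I_m) (a b : phase R m n) : R :=
  \sum_(i < n) (a.1.1 0 i * b.2 i mu - b.1.1 0 i * a.2 i mu).

Definition dHdu (H : phase R m n -> R) (i : 'I_n) (q : phase R m n) : R :=
  'D_((delta_mx 0 i, 0, 0) : phase R m n) H q.

Definition dHdp (H : phase R m n -> R) (i : 'I_n) (q : phase R m n) : R :=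
  'D_((0, delta_mx 0 i, 0) : phase R m n) H q.

Definition dHdsigma (H : phase R m n -> R) (i : 'I_n) (mu : 'I_m) (q : phase R m n) : R :=
  'D_((0, 0, delta_mx i mu) : phase R m n) H q.

Definition partial (mu : 'I_m) (phi : 'rV[R]_m -> R) (x : 'rV[R]_m) : R :=
  'D_(delta_mx 0 mu : 'rV[R]_m) phi x.

Definition grad (u : 'rV[R]_m -> 'rV[R]_n) (x : 'rV[R]_m) : 'M[R]_(n, m) :=
  \matrix_(i, mu) partial mu (fun x' => u x' 0 i) x.

Variable Omega : set 'rV[R]_m.

(* A Banach space Y of E-valued functions on Omega is given by its evaluation
   ev; the values of ev y outside Omega are irrelevant. *)
Definition function_space (Y : completeNormedModType R) (E : normedModType R)
    (ev : Y -> 'rV[R]_m -> E) : Prop :=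
  (forall x, Omega x -> linear (ev ^~ x)) /\
  (forall y y', (forall x, Omega x -> ev y x = ev y' x) -> y = y').

Definition continuous_evaluation (Y : completeNormedModType R)
    (E : normedModType R) (ev : Y -> 'rV[R]_m -> E) : Prop :=
  forall x, Omega x -> continuous (ev ^~ x).

(* H is given for (u, p, sigma) in dom x. *)
Variables (H : 'rV[R]_m -> phase R m n -> R) (dom : 'rV[R]_m -> set (phase R m n)).

Definition deDonderWeyl (u p : R -> 'rV[R]_m -> 'rV[R]_n)
    (s : R -> 'rV[R]_m -> 'M[R]_(n, m)) (t : R) : Prop :=
  forall x, Omega x ->
    let q : phase R m n := (u t x, p t x, s t x) in
    dom x q /\
    forall i : 'I_n,
    [/\ derive1 (fun t' => u t' x 0 i) t = dHdp (H x) i q,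
        forall mu, partial mu (fun x' => u t x' 0 i) x = dHdsigma (H x) i mu q
      & - (derive1 (fun t' => p t' x 0 i) t
           + \sum_(mu < m) partial mu (fun x' => s t x' i mu) x)
        = dHdu (H x) i q].

Variables (Y S : completeNormedModType R).
Variable evY : Y -> 'rV[R]_m -> ('rV[R]_n * 'rV[R]_n)%type.
Variable evS : S -> 'rV[R]_m -> 'M[R]_(n, m).

(* At the fields (u, p) of Y, the equation grad u = dH/dsigma has, within the
   domain of H (which may select a branch), exactly one solution, namely
   shat(x, u, p, grad u), and sigma(y) is the field of these solutions. *)
Definition implicit_sigma
    (shat : 'rV[R]_m -> 'rV[R]_n -> 'rV[R]_n -> 'M[R]_(n, m) -> 'M[R]_(n, m))
    (sigma : Y -> S) : Prop :=
  forall y x, Omega x ->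
    let u x' := (evY y x').1 in
    let p x' := (evY y x').2 in
    (forall s : 'M[R]_(n, m),
      (dom x (u x, p x, s) /\
       forall i mu, grad u x i mu = dHdsigma (H x) i mu (u x, p x, s))
      <-> s = shat x (u x) (p x) (grad u x)) /\
    evS (sigma y) x = shat x (u x) (p x) (grad u x).

(* The de Donder--Weyl equations for (u, p) = y and s can be written as
   y' = f(y), with s = sigma(y). *)
Definition written_as_ode (f : Y -> Y) (sigma : Y -> S) : Prop :=
  forall (y : R -> Y) (s : R -> S) (t : R), derivable y t 1 ->
    deDonderWeyl (fun t x => (evY (y t) x).1) (fun t x => (evY (y t) x).2)
      (fun t x => evS (s t) x) t
    <-> derive1 y t = f (y t) /\ s t = sigma (y t).

(* (v, r, tau) at the point x, for xi = (v, r) and tau = sigma'(y) xi *)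
Definition variation (sigma : Y -> S) (y xi : Y) (x : 'rV[R]_m) : phase R m n :=
  ((evY xi x).1, (evY xi x).2, evS ('d sigma y xi) x).

Variables (Z : completeNormedModType R) (evZ : Z -> 'rV[R]_m -> R).

Definition density_omega0 (sigma : Y -> S) (W0 : Y -> Y -> Z) : Prop :=
  forall y xi eta x, Omega x ->
    evZ (W0 xi eta) x
    = omega0 (variation sigma y xi x) (variation sigma y eta x).

Definition augmented_field (f : Y -> Y) (sigma : Y -> S)
    (g : Y * Y * Y * Z -> Y * Y * Y * Z) : Prop :=
  forall y xi eta z,
    (g (y, xi, eta, z)).1 = (f y, 'd f y xi, 'd f y eta) /\
    forall x, Omega x ->
      evZ (g (y, xi, eta, z)).2 x
      = - \sum_(mu < m)
          partial mu (fun x' => omega mu (variation sigma y xi x')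
                                         (variation sigma y eta x')) x.

End DeDonderWeyl.

(* Main.v *)
Require Import Defs.
From HB Require Import structures.
From mathcomp Require Import all_boot all_order all_algebra.
From mathcomp Require Import sesquilinear.
From mathcomp Require Import boolp classical_sets functions reals topology normedtype derive.
From mathcomp Require Import landau sequences.
From mathcomp Require Import ring lra.

Set Implicit Arguments.
Unset Strict Implicit.
Unset Printing Implicit Defensive.

Import Order.TTheory GRing.Theory Num.Theory.
Import numFieldNormedType.Exports.

Local Open Scope classical_set_scope.
Local Open Scope ring_scope.

(** Conservation law: at every [y] the curve [t |-> y + t f(y)] turns
    [written_as_ode] into the de Donder--Weyl equations for the fields
    [y, f(y), sigma(y)].  Differentiating these identities in [y] along [xi] gives
    the linearised equations; contracting them with [eta] and antisymmetrising,
    the second derivative of [H] cancels by symmetry, and what is left is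
    [W0 (f'(y) xi) eta + W0 xi (f'(y) eta) = - div omega(xi, eta)].  Moving the
    derivative through [div] needs continuity of [s |-> d_mu s(x)] on [S], which
    is Banach--Steinhaus applied to difference quotients.

    Integrator: by this identity [z - W0 xi eta] is a quadratic invariant of the
    augmented field, so it remains to see that [Phi] maps the tangent field
    [(f(y), f'(y) xi)] to the tangent map of [Phi_f].  For a fixed step [e <> 0]
    the field [(f(x), (f(x + e xi) - f(x)) / e)] is affinely conjugate to
    [f * f], on which [Phi] acts componentwise.  Made a state variable with zero
    velocity, [e] can be sent to 0 by continuity of [Phi] on [Y * Y * R]; there
    the quotient is the smooth map
    [(x, xi, e) |-> int_0^1 f'(x + s e xi) xi ds]. *)

(** * Calculus of smooth maps *)

Section SmoothCalculus.
Variable R : realType.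
Implicit Types U V W X : normedModType R.

Definition tangent V W (f : V -> W) (z : V * V) : W := 'd f (z.1) (z.2).

Lemma CkS V W (f : V -> W) k :
  Ck k.+1 setT f <->
  (forall y, differentiable f y) /\ Ck k setT (tangent f).
Proof.
rewrite /= (_ : setT `*` setT = setT :> set (V * V)); last first.
  by apply/seteqP; split.
by split=> -[df cf]; split=> // y; exact: df.
Qed.

Lemma Ck0 V W (f : V -> W) : Ck 0 setT f <-> continuous f.
Proof. by split=> [cf y|cf y _]; exact: cf. Qed.

Lemma CkW k V W (f : V -> W) : Ck k.+1 setT f -> Ck k setT f.
Proof.
elim: k V W f => [|k IH] V W f /CkS[df cf].
  by apply/Ck0 => y; exact: differentiable_continuous.
by apply/CkS; split=> //; exact: IH.
Qed.

Lemma Ck_lin k V W (L : {linear V -> W}) : continuous L -> Ck k setT L.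
Proof.
elim: k V W L => [|k IH] V W L cL; first exact/Ck0.
apply/CkS; split=> [y|]; first exact: linear_differentiable.
rewrite (_ : tangent L = (L \o snd : {linear _ -> _})).
  by apply: IH => z /=; apply: continuous_comp; [exact: cvg_snd|exact: cL].
by apply/funext => z; rewrite /tangent diff_lin.
Qed.

Lemma Ck_linear k V W (L : V -> W) : linear L -> continuous L -> Ck k setT L.
Proof.
move=> lL cL.
pose L' : {linear V -> W} := HB.pack L (GRing.isLinear.Build _ _ _ _ _ lL).
exact: (@Ck_lin k _ _ L').
Qed.

Lemma Ck_cst k V W (c : W) : Ck k setT (fun _ : V => c).
Proof.
elim: k V W c => [|k IH] V W c; first by apply/Ck0 => y; exact: cvg_cst.
apply/CkS; split=> [y|]; first exact: differentiable_cst.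
rewrite (_ : tangent _ = fun=> 0); first exact: IH.
by apply/funext => z; rewrite /tangent diff_cst.
Qed.

Lemma continuous_pair V W X (f : V -> W) (g : V -> X) :
  continuous f -> continuous g -> continuous (fun y => (f y, g y)).
Proof. by move=> cf cg y; apply: cvg_pair; [exact: cf|exact: cg]. Qed.

Lemma Ck_pair k V W X (f : V -> W) (g : V -> X) :
  Ck k setT f -> Ck k setT g -> Ck k setT (fun y => (f y, g y)).
Proof.
elim: k V W X f g => [|k IH] V W X f g.
  by move=> /Ck0 cf /Ck0 cg; apply/Ck0; exact: continuous_pair.
move=> /CkS[df cf] /CkS[dg cg]; apply/CkS; split=> [y|].
  exact: differentiable_pair.
rewrite (_ : tangent _ = fun z => (tangent f z, tangent g z)); first exact: IH.
by apply/funext => z; rewrite /tangent diff_pair.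
Qed.

Lemma Ck_fst k V W : Ck k setT (fst : V * W -> V).
Proof. by apply: Ck_lin => z; exact: cvg_fst. Qed.

Lemma Ck_snd k V W : Ck k setT (snd : V * W -> W).
Proof. by apply: Ck_lin => z; exact: cvg_snd. Qed.

Lemma tangent_comp V W X (f : V -> W) (g : W -> X) :
  (forall y, differentiable f y) -> (forall y, differentiable g y) ->
  tangent (g \o f) = tangent g \o (fun z => (f z.1, tangent f z)).
Proof. by move=> df dg; apply/funext => z; rewrite /tangent diff_comp. Qed.

(** By the chain rule the tangent of [g \o f] is [tangent g] after the pair of [f \o fst] and
    [tangent f]. The induction hypothesis serves for this composition and once more for
    [f \o fst]. *)
Lemma Ck_comp k V W X (f : V -> W) (g : W -> X) :
  Ck k setT f -> Ck k setT g -> Ck k setT (g \o f).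
Proof.
elim: k V W X f g => [|k IH] V W X f g.
  move=> /Ck0 cf /Ck0 cg; apply/Ck0 => y.
  by apply: continuous_comp; [exact: cf|exact: cg].
move=> Cf /CkS[dg cg]; have /CkS[df cf] := Cf.
apply/CkS; split=> [y|]; first exact: differentiable_comp.
rewrite tangent_comp//; apply: (IH) => //; apply: Ck_pair => //.
exact: (IH _ _ _ fst f (Ck_fst _ _ _) (CkW Cf)).
Qed.

Lemma Ck_add k V W (f g : V -> W) :
  Ck k setT f -> Ck k setT g -> Ck k setT (fun y => f y + g y).
Proof.
move=> cf cg.
have Cadd : Ck k setT (fun z : W * W => z.1 + z.2).
  apply: Ck_linear => [a x y /=|]; last exact: add_continuous.
  by rewrite scalerDr addrACA.
exact: (Ck_comp (Ck_pair cf cg) Cadd).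
Qed.

(** The tangent of [B] is a sum of two copies of [B] composed with projections, so the induction on
    [k] closes on [B] itself. *)
Lemma Ck_bilin k U V W (B : {bilinear U -> V -> W}) :
  continuous (fun p : U * V => B p.1 p.2) ->
  Ck k setT (fun p : U * V => B p.1 p.2).
Proof.
move=> cB; elim: k => [|k IH]; first exact/Ck0.
apply/CkS; split=> [y|]; first exact: differentiable_bilin.
rewrite (_ : tangent _ = fun z : (U * V) * (U * V) =>
    B z.1.1 z.2.2 + B z.2.1 z.1.2); last first.
  by apply/funext => z; rewrite /tangent diff_bilin.
have c1 := @Ck_fst k (U * V)%type (U * V)%type.
have c2 := @Ck_snd k (U * V)%type (U * V)%type.
have c1' := @Ck_fst k U V; have c2' := @Ck_snd k U V.
apply: Ck_add.
  exact: (Ck_comp (Ck_pair (Ck_comp c1 c1') (Ck_comp c2 c2')) IH).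
exact: (Ck_comp (Ck_pair (Ck_comp c2 c1') (Ck_comp c1 c2')) IH).
Qed.

Lemma Ck_scale k V W (a : V -> R) (f : V -> W) :
  Ck k setT a -> Ck k setT f -> Ck k setT (fun y => a y *: f y).
Proof.
move=> ca cf.
have bil : bilinear_for (GRing.Scale.Law.clone _ _ *:%R _)
    (GRing.Scale.Law.clone _ _ *:%R _) ( *:%R : R -> W -> W).
  split=> [u'|u] b x y /=; first by rewrite scalerDl scalerA.
  by rewrite scalerDr !scalerA mulrC.
pose B : {bilinear R -> W -> W} :=
  HB.pack ( *:%R : R -> W -> W) (bilinear_isBilinear.Build R R W W _ _ _ bil).
have CB : Ck k setT (fun p : R * W => B p.1 p.2).
  by apply: Ck_bilin => p; exact: scale_continuous.
exact: (Ck_comp (Ck_pair ca cf) CB).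
Qed.

Lemma smooth_tangent V W (f : V -> W) : smooth f -> smooth (tangent f).
Proof. by move=> sf k; have /CkS[] := sf k.+1. Qed.

Lemma smooth_differentiable V W (f : V -> W) y :
  smooth f -> differentiable f y.
Proof. by move=> /(_ 1)/CkS[]. Qed.

End SmoothCalculus.

(** * Mean value inequality *)

Section MeanValueInequality.
Variable R : realType.

(** Continuous induction: the local hypothesis at the supremum of the points reached from [a]
    carries [P a] beyond that supremum, unless it is already [b]. *)
Lemma cousin (P : R -> R -> Prop) (a b : R) : a <= b ->
  (forall x y z, x <= y -> y <= z -> P x y -> P y z -> P x z) ->
  (forall t, a <= t <= b -> exists2 d, d > 0 &
     forall x y, x <= t -> t <= y -> t - x < d -> y - t < d -> P x y) ->
  P a b.
Proof.
move=> ab Ptrans Ploc.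
pose A := [set x | a <= x <= b /\ P a x].
have Aa : A a.
  split; first by rewrite lexx.
  have [|d d0 H] := Ploc a; first by rewrite lexx.
  by apply: H; rewrite ?subrr.
have ubA : ubound A b by move=> x [/andP[]].
have hsA : has_sup A by split; [exists a|exists b].
have as_ : a <= sup A by apply: ub_le_sup => //; exists b.
have sb : sup A <= b by apply: ge_sup => //; exists a.
have [|d d0 Hd] := Ploc (sup A); first by rewrite as_.
have [x [/andP[ax xb] Pax] sx] := sup_adherent d0 hsA.
have xs : x <= sup A by apply: ub_le_sup; [exists b|split => //; rewrite ax].
(* [y] exceeds [sup A] unless [sup A = b], yet it turns out to lie in [A]; hence [y = b]. *)
pose y := Num.min b (sup A + d / 2).
have sy : sup A <= y by rewrite le_min sb/= lerDl divr_ge0// ltW.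
have yd : y - sup A < d.
  rewrite ltrBlDl; apply: le_lt_trans (_ : sup A + d / 2 < _).
    by rewrite ge_min lexx orbT.
  by rewrite ltrD2l ltr_pdivrMr// ltr_pMr// ltr1n.
have Pay : P a y.
  apply: (Ptrans _ x) => //; first exact: le_trans sy.
  by apply: Hd => //; rewrite ltrBlDl -ltrBlDr.
have ys : y <= sup A.
  apply: ub_le_sup; first by exists b.
  by split=> //; rewrite (le_trans as_ sy)/= ge_min lexx.
suff <- : y = b by [].
apply/eqP; rewrite eq_le ge_min lexx/= leNgt; apply/negP => yb.
move: ys; rewrite /y ge_min leNgt => /orP[|].
  by rewrite (le_lt_trans _ yb).
by rewrite gerDl leNgt divr_gt0.
Qed.

Lemma diff_near (V W : normedModType R) (f : V -> W) (x : V) (e : R) :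
  differentiable f x -> 0 < e ->
  \forall h \near 0, `|f (x + h) - f x - 'd f x h| <= e * `|h|.
Proof.
move=> /diff_locally/eqaddoP H /H; apply: filterS => h /=.
by rewrite !fctE /= opprD addrA [h + x]addrC.
Qed.

(** For each slack [k > 0] the bound [(M + k) (y - x)] holds near every point by differentiability
    and adds up over adjacent intervals, which is what [cousin] asks for. *)
Lemma mvt_le (W : normedModType R) (c : R -> W) (a b M : R) : a <= b ->
  (forall t, a <= t <= b -> differentiable c t) ->
  (forall t, a <= t <= b -> `|'d c t 1| <= M) ->
  `|c b - c a| <= M * (b - a).
Proof.
move=> ab dc cM; apply/ler_addgt0Pr => e e0.
(* The summand 1 keeps the denominator positive when [a = b]. *)
have [k0 ke] : 0 < e / (b - a + 1) /\ e / (b - a + 1) * (b - a) <= e.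
  have ba : 0 < b - a + 1 by rewrite ltr_wpDl// subr_ge0.
  split; first by rewrite divr_gt0.
  by rewrite mulrAC ler_pdivrMr// ler_pM2l// lerDl.
set k := e / _ in k0 ke.
apply: (@le_trans _ _ ((M + k) * (b - a))); last by rewrite mulrDl lerD2l.
apply: (cousin (P := fun x y => `|c y - c x| <= (M + k) * (y - x))) => //.
  move=> x y z _ _ Pxy Pyz.
  have -> : c z - c x = (c z - c y) + (c y - c x) by rewrite addrA subrK.
  rewrite (le_trans (ler_normD _ _))// (le_trans (lerD Pyz Pxy))//.
  by rewrite -mulrDr addrA subrK.
move=> t tab.
have /nbhs_ballP[d d0 Hd] := diff_near (dc t tab) k0.
have step h : `|h| < d -> `|c (t + h) - c t| <= (M + k) * `|h|.
  move=> hd; have /Hd/= : ball (0 : R) d h by rewrite -ball_normE/= sub0r normrN.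
  rewrite (_ : 'd c t h = h *: 'd c t 1); last first.
    by rewrite -linearZ/= /GRing.scale/= mulr1.
  move=> H; rewrite -[X in `|X|](subrK (h *: 'd c t 1)).
  rewrite (le_trans (ler_normD _ _))// mulrDl addrC lerD// normrZ mulrC.
  by rewrite ler_wpM2r// cM.
exists d => // x y xt ty txd ytd.
have -> : c y - c x = (c y - c t) + (c t - c x) by rewrite addrA subrK.
rewrite (le_trans (ler_normD _ _))//.
have -> : y - x = (y - t) + (t - x) by rewrite addrA subrK.
rewrite mulrDr lerD//.
  have yt0 : 0 <= y - t by rewrite subr_ge0.
  by have := step (y - t); rewrite ger0_norm// [t + _]addrC subrK; apply.
have yt0 : 0 <= t - x by rewrite subr_ge0.
have := step (x - t); rewrite distrC ger0_norm// [t + _]addrC subrK.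
by rewrite distrC; apply.
Qed.

End MeanValueInequality.

(** * Riemann integral of Banach-valued functions *)

Section RiemannIntegral.
Variable R : realType.

(** Tube lemma: compactness of the unit segment turns neighbourhoods that depend on [s] into one
    that serves all [s]. *)
Lemma near_unit_segment (T : Type) (F : set_system T) (P : T -> R -> Prop) :
  Filter F ->
  (forall s : R, 0 <= s <= 1 -> \forall s' \near s & t \near F, P t s') ->
  \forall t \near F, forall s : R, 0 <= s <= 1 -> P t s.
Proof.
move=> FF H.
have /compact_near_coveringP cov := @segment_compact R 0 1.
have : \near F, `[0, 1]%classic `<=` P F.
  by apply: cov => x; rewrite /= in_itv; exact: H.
by apply: filterS => t sub s s01; apply: sub; rewrite /= in_itv.
Qed.

Variable W : completeNormedModType R.
Implicit Types c : R -> W.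

Definition rsum c (N : nat) : W := N%:R^-1 *: \sum_(i < N) c (i%:R / N%:R).

Lemma sum_ord_mul (N m : nat) (F : nat -> W) :
  \sum_(k < N * m) F k = \sum_(i < N) \sum_(j < m) F (i * m + j)%N.
Proof.
elim: N F => [|N IH] F; first by rewrite !big_ord0.
rewrite mulSn big_split_ord big_ord_recl/=; congr (_ + _).
rewrite (IH (fun k => F (m + k)%N)); apply: eq_bigr => i _.
by apply: eq_bigr => j _; rewrite /bump/= mulSn addnA.
Qed.

Lemma rsum_norm c (M : R) N : (0 < N)%N ->
  (forall s : R, 0 <= s <= 1 -> `|c s| <= M) -> `|rsum c N| <= M.
Proof.
move=> N0 cM.
have NR : 0 < N%:R :> R by rewrite ltr0n.
rewrite /rsum normrZ ger0_norm ?invr_ge0// mulrC ler_pdivrMr//.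
apply: le_trans (ler_norm_sum _ _ _) _.
apply: (@le_trans _ _ (\sum_(i < N) M)); last first.
  by rewrite sumr_const card_ord mulr_natr.
apply: ler_sum => i _; apply: cM.
by rewrite divr_ge0//= ler_pdivrMr// mul1r ler_nat ltnW.
Qed.

Lemma unit_segment_unif_continuous c (e : R) : continuous c -> 0 < e ->
  exists2 d : R, 0 < d & forall s h : R, 0 <= s <= 1 -> `|h| < d -> `|c (s + h) - c s| <= e.
Proof.
move=> cc e0.
have : \forall h \near (0 : R), forall s, 0 <= s <= 1 -> `|c (s + h) - c s| <= e.
  apply: (@near_unit_segment _ (nbhs (0 : R)) (fun h s => `|c (s + h) - c s| <= e)) => s _.
  have : (fun p : R * R => c (p.1 + p.2) - c p.1) p @[p --> (s, 0)] --> (0 : W).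
    rewrite -(subrr (c s)); apply: cvgB; last first.
      by apply: continuous_comp; [exact: cvg_fst|exact: cc].
    rewrite -[X in _ --> c X]addr0.
    exact: (@continuous_comp _ _ _ (fun p : R * R => p.1 + p.2) c (s, 0)
      (@add_continuous _ (s, 0)) (cc _)).
  by move=> /cvgr0_norm_le /(_ e e0).
move=> /nbhs_ballP[d d0 Hd]; exists d => // s h s01 hd; apply: Hd => //.
by rewrite -ball_normE/= sub0r normrN.
Qed.

(** Each node of the finer partition lies within [1 / N < d] of the coarse node to its left, so [c]
    differs there by at most [e]. *)
Lemma rsum_refine c (e d : R) (N m : nat) : (0 < N)%N -> (0 < m)%N ->
  (forall s h : R, 0 <= s <= 1 -> `|h| < d -> `|c (s + h) - c s| <= e) ->
  N%:R^-1 < d -> `|rsum c (N * m) - rsum c N| <= e.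
Proof.
move=> N0 m0 H Nd.
have NR : 0 < N%:R :> R by rewrite ltr0n.
have mR : 0 < m%:R :> R by rewrite ltr0n.
(* Each coarse term is repeated [m] times to match the finer sum term by term. *)
have -> : rsum c N = (N * m)%:R^-1 *: \sum_(i < N) \sum_(j < m) c (i%:R / N%:R).
  rewrite /rsum; under [in RHS]eq_bigr do rewrite sumr_const card_ord.
  rewrite sumrMnl -[_ *+ m]scaler_nat scalerA natrM invfM -mulrA mulVf ?mulr1//.
  by rewrite gt_eqF.
rewrite /rsum (sum_ord_mul _ _ (fun k => c (k%:R / (N * m)%:R))).
rewrite -scalerBr -sumrB.
under eq_bigr do rewrite -sumrB.
rewrite normrZ ger0_norm ?invr_ge0// mulrC ler_pdivrMr; last first.
  by rewrite ltr0n muln_gt0 N0.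
apply: le_trans (ler_norm_sum _ _ _) _.
apply: (@le_trans _ _ (\sum_(i < N) e * m%:R)); last first.
  by rewrite sumr_const card_ord natrM mulrCA mulr_natl.
apply: ler_sum => i _; apply: le_trans (ler_norm_sum _ _ _) _.
apply: (@le_trans _ _ (\sum_(j < m) e)); last first.
  by rewrite sumr_const card_ord mulr_natr.
apply: ler_sum => j _.
have -> : (i * m + j)%:R / (N * m)%:R = i%:R / N%:R + j%:R / (N * m)%:R :> R.
  by rewrite natrD mulrDl !natrM -mulf_div divff ?mulr1// gt_eqF.
apply: H.
  by rewrite divr_ge0//= ler_pdivrMr// mul1r ler_nat ltnW.
rewrite ger0_norm ?divr_ge0//; apply: le_lt_trans Nd.
rewrite natrM invfM mulrCA ler_piMr ?invr_ge0//.
have jm : j%:R <= m%:R :> R by rewrite ler_nat ltnW.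
by rewrite ler_pdivrMr// mul1r.
Qed.

Lemma near_invn (d : R) : 0 < d -> \forall N \near \oo, (0 < N)%N /\ N%:R^-1 < d.
Proof.
move=> d0; exists (Num.bound d^-1).+1 => // N /= bN.
have N0 : (0 < N)%N by exact: leq_ltn_trans bN.
split=> //; rewrite -[ltRHS]invrK ltf_pV2 ?posrE ?invr_gt0 ?ltr0n//.
have d1 : 0 <= d^-1 by rewrite invr_ge0 ltW.
by apply: (lt_le_trans (archi_boundP d1)); rewrite ler_nat ltnW.
Qed.

(** The sums for [M] and [N] are both compared with their common refinement [N * M]. *)
Lemma is_cvg_rsum c : continuous c -> cvg (rsum c @ \oo).
Proof.
move=> cc; apply: cauchy_cvg; apply: cauchy_exP => e e0.
(* Two comparisons cost [2 e / 3], which leaves the strict inequality that a ball requires. *)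
have e3 : 0 < e / 3 by rewrite divr_gt0.
have [d d0 Hd] := unit_segment_unif_continuous cc e3.
have [M [M0 Md]] := filter_ex (near_invn d0).
exists (rsum c M).
change (\forall N \near \oo, ball (rsum c M) e (rsum c N)).
near=> N.
have [N0 Nd] : (0 < N)%N /\ N%:R^-1 < d by near: N; exact: near_invn.
rewrite /= -ball_normE/=.
have H1 := rsum_refine N0 M0 Hd Nd; have := rsum_refine M0 N0 Hd Md.
rewrite mulnC distrC => H2.
rewrite -[_ - _](subrKA (rsum c (N * M))).
apply: le_lt_trans (ler_normD _ _) _; apply: le_lt_trans (lerD H2 H1) _.
lra.
Unshelve. all: by end_near. Qed.

(** By [is_cvg_rsum] the limit exists when [c] is continuous; otherwise [lim] may be a default
    value, hence the continuity hypotheses below. *)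
Definition rint c : W := lim (rsum c @ \oo).

Lemma rint_norm c (M : R) : continuous c ->
  (forall s : R, 0 <= s <= 1 -> `|c s| <= M) -> `|rint c| <= M.
Proof.
move=> cc cM.
have H : `|rsum c N| @[N --> \oo] --> `|rint c|.
  by apply: cvg_norm; exact: is_cvg_rsum.
rewrite -(cvg_lim _ H)//; apply: limr_le; first by apply/cvg_ex; eexists; exact: H.
by exists 1 => // N N0 /=; exact: rsum_norm.
Qed.

Lemma rintD c1 c2 : continuous c1 -> continuous c2 ->
  rint (fun s => c1 s + c2 s) = rint c1 + rint c2.
Proof.
move=> cc1 cc2; apply: cvg_lim => //.
rewrite (_ : rsum _ = fun N => rsum c1 N + rsum c2 N).
  by apply: cvgD; exact: is_cvg_rsum.
by apply/funext => N; rewrite /rsum big_split/= scalerDr.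
Qed.

Lemma rintZ (k : R) c : continuous c -> rint (fun s => k *: c s) = k *: rint c.
Proof.
move=> cc; apply: cvg_lim => //.
rewrite (_ : rsum _ = fun N => k *: rsum c N).
  by apply: cvgZl_tmp; exact: is_cvg_rsum.
by apply/funext => N; rewrite /rsum -scaler_sumr !scalerA mulrC.
Qed.

Lemma rintB c1 c2 : continuous c1 -> continuous c2 ->
  rint (fun s => c1 s - c2 s) = rint c1 - rint c2.
Proof.
move=> cc1 cc2; rewrite -[- rint c2]scaleN1r -rintZ// -rintD//.
  by congr rint; apply/funext => s; rewrite scaleN1r.
by move=> s; apply: cvgZl_tmp; exact: cc2.
Qed.

(* Telescoping: by the mean value inequality the increment of [c] over
   [i/N, (i+1)/N] differs from [c'(i/N) / N] by at most [e / N]. *)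
Lemma rint_ftc c c' : continuous c' ->
  (forall t, differentiable c t) -> (forall t, 'd c t 1 = c' t) ->
  rint c' = c 1 - c 0.
Proof.
move=> cc' dc dcE; apply: cvg_lim => //; apply/cvgrPdist_le => e e0.
have [d d0 Hd] := unit_segment_unif_continuous cc' e0.
near=> N.
have [N0 Nd] : (0 < N)%N /\ N%:R^-1 < d by near: N; exact: near_invn.
have NR : 0 < N%:R :> R by rewrite ltr0n.
pose C i := c (i%:R / N%:R).
have -> : c 1 - c 0 = \sum_(i < N) (C i.+1 - C i).
  rewrite -(big_mkord predT (fun i => C i.+1 - C i)) telescope_sumr//.
  by rewrite /C divff ?gt_eqF// mul0r.
rewrite /rsum scaler_sumr -sumrB.
apply: le_trans (ler_norm_sum _ _ _) _.
apply: (@le_trans _ _ (\sum_(i < N) e / N%:R)); last first.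
  by rewrite sumr_const card_ord -[X in X <= _]mulr_natr divfK ?gt_eqF.
apply: ler_sum => i _.
set t0 := i%:R / N%:R.
have t01 : 0 <= t0 <= 1.
  by rewrite divr_ge0//= ler_pdivrMr// mul1r ler_nat ltnW.
have t1E : i.+1%:R / N%:R = t0 + N%:R^-1 by rewrite -addn1 natrD mulrDl mul1r.
pose D t := c t - t *: c' t0.
have dD t : is_diff t D (('d c t : R -> W) - (fun h : R => h *: c' t0)).
  have ? := differentiableP (dc t).
  by rewrite /D; apply: is_diff_eq.
have : `|D (t0 + N%:R^-1) - D t0| <= e * (t0 + N%:R^-1 - t0).
  apply: mvt_le => [|t _|t /andP[tt1 tt2]]; first by rewrite lerDl invr_ge0 ler0n.
    exact: ex_diff.
  rewrite diff_val /= !fctE scale1r dcE -[t](subrK t0).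
  rewrite [t - t0 + t0]addrC; apply: Hd => //; rewrite ger0_norm ?subr_ge0//.
  by rewrite (le_lt_trans _ Nd)// lerBlDl.
rewrite /D /C t1E [t0 + _ - t0]addrC addKr => H; apply: le_trans H.
rewrite scalerDl opprB opprD !addrA [_ - N%:R^-1 *: _ + _]addrAC subrK.
by rewrite [c _ - _ - _]addrAC.
Unshelve. all: by end_near. Qed.

End RiemannIntegral.

(** * Strict differentiability *)

Section LineDifferential.
Variables (R : realType) (V W : normedModType R).

Lemma line_is_diff (p v : V) (t : R) :
  is_diff t (fun r : R => p + r *: v) (fun r : R => r *: v).
Proof.
have -> : (fun r : R => p + r *: v) = cst p + (fun r : R => r *: v) by [].
have := is_diffD (is_diff_cst p t) (is_diff_scalel t v).
by rewrite add0r.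
Qed.

Lemma line_differentiable (h : V -> W) (p v : V) (t : R) :
  differentiable h (p + t *: v) -> differentiable (fun r : R => h (p + r *: v)) t.
Proof.
by move=> dh; apply: (@differentiable_comp _ _ _ _ (fun r : R => p + r *: v) h).
Qed.

Lemma line_diff (h : V -> W) (p v : V) (t : R) :
  differentiable h (p + t *: v) ->
  'd (fun r : R => h (p + r *: v)) t 1 = 'd h (p + t *: v) v.
Proof.
move=> dh; have dl := line_is_diff p v t.
have := @diff_comp _ _ _ _ (fun r : R => p + r *: v) h t (@ex_diff _ _ _ _ _ _ _ dl) dh.
by move=> /(congr1 (@^~ 1)) ->; rewrite /= diff_val scale1r.
Qed.

End LineDifferential.

Section StrictDifferentiability.
Variables (R : realType) (V W : normedModType R).

(** Homogeneity in [v] is that of a differential. Homogeneity in [u] holds because the expression is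
    the derivative along [v] of [q |-> 'd h q u], which is linear in [u]. *)
Lemma tangent2_scale (h : V -> W) (p u v : V) (a b : R) :
  (forall y, differentiable (tangent h) y) ->
  tangent (tangent h) ((p, a *: u), (b *: v, 0)) =
  (a * b) *: tangent (tangent h) ((p, u), (v, 0)).
Proof.
move=> dh.
have dD w : tangent (tangent h) ((p, w), (v, 0)) =
    'D_v (fun q => 'd h q w) p.
  transitivity ('D_(v, 0) (tangent h) (p, w)); first by rewrite deriveE.
  rewrite /derive.
  set f1 := (fun t : R => _); set f2 := (fun t : R => _).
  suff -> : f1 = f2 by [].
  by apply/funext => t; rewrite /f1 /f2 /tangent/= scaler0 add0r.
have dw w : derivable (fun q => 'd h q w) p v.
  have : derivable (tangent h) (p, w) (v, 0) by exact: diff_derivable.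
  rewrite /derivable.
  rewrite (_ : (fun t => _) = (fun t : R => t^-1 *: ('d h (t *: v + p) w - 'd h p w))) //.
  by apply/funext => t; rewrite /tangent/= scaler0 add0r.
rewrite (_ : (b *: v, 0) = b *: (v, 0) :> V * V); last first.
  by congr pair; rewrite /= scaler0.
rewrite {1}/tangent /= linearZ/= [in RHS]mulrC -scalerA; congr (_ *: _).
rewrite -[LHS]/(tangent (tangent h) ((p, a *: u), (v, 0))) !dD.
rewrite -deriveZ//; congr ('D_v _ p).
by apply/funext => q /=; rewrite linearZ.
Qed.

(* The quadratic bound on the remainder comes from the boundedness of the
   second derivative near [((p, 0), (0, 0))], by homogeneity. *)
Lemma Ck2_strict_diff (h : V -> W) (p : V) (e : R) : Ck 2 setT h -> 0 < e ->
  \forall p' \near p & k \near (0 : V),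
    `|h (p' + k) - h p' - 'd h p' k| <= e * `|k|.
Proof.
move=> /CkS[dh /CkS[dTh /Ck0 cTTh]] e0.
pose B (q u v : V) := tangent (tangent h) ((q, u), (v, 0)).
have B0 : B p 0 0 = 0 by rewrite /B /tangent linear0.
have [d d0 Bd] : exists2 d : R, 0 < d & forall q u v,
    `|p - q| < d -> `|u| < d -> `|v| < d -> `|B q u v| <= 1.
  have := cTTh ((p, 0), (0, 0)).
  rewrite /continuous_at -/(B p 0 0) B0 => /cvgr0_norm_le /(_ _ ltr01).
  move=> /nbhs_ballP[d d0 Hd]; exists d => // q u v pq u0 v0.
  apply: (Hd ((q, u), (v, 0))); split; split => /=.
  - by rewrite -ball_normE.
  - by rewrite -ball_normE/= sub0r normrN.
  - by rewrite -ball_normE/= sub0r normrN.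
  - exact: ballxx.
(* This comes from rescaling [u] to norm [d / 2], where [B] is bounded by 1; homogeneity of degree
   two produces the square. *)
pose C := (2 / d) ^+ 2.
have C0 : 0 < C by rewrite exprn_gt0// divr_gt0.
have BC q u : `|p - q| < d -> `|B q u u| <= C * `|u| ^+ 2.
  move=> pq; have [->|u0] := eqVneq u 0.
    by rewrite /B /tangent linear0 !normr0 expr0n/= mulr0.
  have nu : 0 < `|u| by rewrite normr_gt0.
  pose k := d / (2 * `|u|).
  have k0 : 0 < k by rewrite divr_gt0// mulr_gt0.
  have ku : `|k *: u| < d.
    rewrite normrZ gtr0_norm// /k invfM mulrA divfK ?gt_eqF//.
    by rewrite ltr_pdivrMr// ltr_pMr// ltr1n.
  have := Bd q (k *: u) (k *: u) pq ku ku.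
  rewrite /B tangent2_scale// normrZ (ger0_norm (mulr_ge0 (ltW k0) (ltW k0))).
  rewrite -ler_pdivlMl; last exact: mulr_gt0.
  rewrite mulr1 => /le_trans; apply.
  by rewrite -expr2 -exprVn /k invf_div mulrAC exprMn.
have d2 : 0 < d / 2 by rewrite divr_gt0.
near=> p' k.
have pp' : `|p - p'| < d / 2.
  have : ball p (d / 2) p' by near: p'; exact: nbhsx_ballx.
  by rewrite -ball_normE.
have kd : `|k| < d / 2.
  have : ball (0 : V) (d / 2) k by near: k; exact: nbhsx_ballx.
  by rewrite -ball_normE/= sub0r normrN.
have kC : C * `|k| <= e.
  have : ball (0 : V) (e / C) k by near: k; apply: nbhsx_ballx; exact: divr_gt0.
  by rewrite -ball_normE/= sub0r normrN ltr_pdivlMr// mulrC => /ltW.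
have near_p r : 0 <= r <= 1 -> `|p - (p' + r *: k)| < d.
  move=> /andP[r0 r1]; rewrite opprD addrA.
  apply: le_lt_trans (ler_normB _ _) _; rewrite (splitr d) ltrD//.
  by rewrite normrZ ger0_norm// (le_lt_trans _ kd)// ler_piMl.
(* The mean value inequality is used twice: here for the derivative along the segment, then for the
   remainder [D]. *)
have dTk r : 0 <= r <= 1 -> `|'d h (p' + r *: k) k - 'd h p' k| <= e * `|k|.
  move=> /andP[r0 r1].
  pose c t := tangent h ((p', k) + t *: (k, 0)).
  have cE t : c t = 'd h (p' + t *: k) k.
    by rewrite /c /tangent/= scaler0 addr0.
  rewrite -cE -[X in 'd h X k]addr0 -(scale0r k) -cE.
  apply: (@le_trans _ _ (C * `|k| ^+ 2 * (r - 0))).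
    apply: mvt_le => // t; first by move=> _; exact: line_differentiable.
    move=> /andP[t0 tr]; rewrite line_diff//.
    have -> : (p', k) + t *: (k, 0) = (p' + t *: k, k) :> V * V.
      by congr pair; rewrite /= scaler0 addr0.
    by apply: BC; apply: near_p; rewrite t0 (le_trans tr).
  apply: (@le_trans _ _ (C * `|k| ^+ 2)); last by rewrite expr2 mulrA ler_wpM2r.
  rewrite subr0 ler_piMr//; apply: mulr_ge0; first exact: ltW.
  exact: exprn_ge0.
pose D (r : R) := h (p' + r *: k) - r *: 'd h p' k.
have dD (r : R) :
    is_diff r D (('d (fun t : R => h (p' + t *: k)) r : R -> W) - (fun t : R => t *: 'd h p' k)).
  have dl := differentiableP (line_differentiable (dh (p' + r *: k))).
  exact: (is_diffB dl (is_diff_scalel r ('d h p' k))).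
have -> : h (p' + k) - h p' - 'd h p' k = D 1 - D 0.
  by rewrite /D !scale1r !scale0r addr0 subr0 addrAC.
rewrite -[leRHS]mulr1 -[X in _ * X](subr0 1).
apply: mvt_le => // r r01; rewrite diff_val !fctE line_diff// scale1r.
exact: dTk.
Unshelve. all: by end_near. Qed.

End StrictDifferentiability.

(** * Averages along segments *)

Section Average.
Variable R : realType.

Lemma is_diff_near (V W : normedModType R) (f L : V -> W) (x : V) :
  linear L -> continuous L ->
  (forall e, 0 < e -> \forall k \near (0 : V), `|f (x + k) - f x - L k| <= e * `|k|) ->
  is_diff x f L.
Proof.
move=> lL cL H.
pose L' : {linear V -> W} := HB.pack L (GRing.isLinear.Build _ _ _ _ _ lL).
have E : f \o shift x = cst (f x) + (L' : V -> W) +o_ 0 id.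
  apply/eqaddoP => e /H; apply: filterS => k.
  by rewrite !fctE /= opprD addrA [k + x]addrC.
have dE : 'd f x = L' :> (V -> W) by exact: diff_unique.
by apply: DiffDef; [apply/diff_locallyP; rewrite dE|].
Qed.

Definition avg (V : normedModType R) (W : completeNormedModType R) (h : V -> W)
  (z : V * V) : W := rint (fun s => h (z.1 + s *: z.2)).

Section AverageContinuity.
Variables (V : normedModType R) (W : completeNormedModType R).
Implicit Type h : V -> W.

Lemma segment_continuous (p : R * (V * V)) :
  (fun q : R * (V * V) => q.2.1 + q.1 *: q.2.2) @ p --> p.2.1 + p.1 *: p.2.2.
Proof.
apply: cvgD.
  by apply: (@cvg_comp _ _ _ snd fst _ (nbhs p.2)); [exact: cvg_snd|exact: cvg_fst].
apply: cvgZ; first exact: cvg_fst.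
by apply: (@cvg_comp _ _ _ snd snd _ (nbhs p.2)); [exact: cvg_snd|exact: cvg_snd].
Qed.

Lemma line_continuous h (z : V * V) : continuous h ->
  continuous (fun s : R => h (z.1 + s *: z.2)).
Proof.
move=> ch s.
have c2 : (fun t : R => z.1 + t *: z.2) @ s --> z.1 + s *: z.2.
  by apply: cvgD; [exact: cvg_cst|apply: cvgZr_tmp].
exact: (@continuous_comp _ _ _ (fun t : R => z.1 + t *: z.2) h s c2 (ch _)).
Qed.

(** By compactness the integrands at [z] and at a nearby [w] are uniformly close on the unit
    segment, and [rint_norm] integrates this. *)
Lemma avg_continuous h : continuous h -> continuous (avg h).
Proof.
move=> ch z; apply/cvgrPdist_le => e e0.
have : \forall w \near z, forall s : R, 0 <= s <= 1 ->
    `|h (z.1 + s *: z.2) - h (w.1 + s *: w.2)| <= e.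
  apply: (@near_unit_segment _ _ (nbhs z) (fun w s =>
    `|h (z.1 + s *: z.2) - h (w.1 + s *: w.2)| <= e)) => s _.
  have : (fun q : R * (V * V) => h (z.1 + q.1 *: z.2) - h (q.2.1 + q.1 *: q.2.2)) q
      @[q --> (s, z)] --> (0 : W).
    rewrite -(subrr (h (z.1 + s *: z.2))); apply: cvgB.
      apply: (@cvg_comp _ _ _ fst (fun t : R => h (z.1 + t *: z.2)) _ (nbhs s)).
        exact: cvg_fst.
      exact: line_continuous.
    apply: (@cvg_comp _ _ _ (fun q : R * (V * V) => q.2.1 + q.1 *: q.2.2) h
       _ (nbhs (z.1 + s *: z.2))); last exact: ch.
    exact: (@segment_continuous (s, z)).
  by move=> /cvgr0_norm_le /(_ e e0).
apply: filterS => w H.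
rewrite /avg -rintB; [|exact: line_continuous..].
apply: rint_norm => // s; apply: cvgB; exact: line_continuous.
Qed.

End AverageContinuity.

Section AverageDifferential.
Variables (V : normedModType R) (W : completeNormedModType R).
Implicit Type h : V -> W.

(** The canonical flip of the second tangent bundle. It turns a segment and its variation into one
    segment in [V * V], whose points carry their own variations. *)
Definition interchange (z : (V * V) * (V * V)) : (V * V) * (V * V) :=
  ((z.1.1, z.2.1), (z.1.2, z.2.2)).

(** Differentiation under the integral. Strict differentiability lets the base point [z.1 + s z.2]
    move with [s], so that compactness yields one remainder bound for all [s]. *)
Lemma avg_is_diff h (z : V * V) : Ck 2 setT h ->
  is_diff z (avg h) (fun k => avg (tangent h) (interchange (z, k))).
Proof.
move=> Ch; have /CkS[dh Cth] := Ch.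
have ch : continuous h by move=> y; exact: differentiable_continuous.
have cth : continuous (tangent h) by exact/Ck0/CkW.
have ck k : continuous (fun s : R => tangent h
    ((interchange (z, k)).1 + s *: (interchange (z, k)).2)).
  exact: line_continuous.
apply: is_diff_near.
- move=> a k1 k2; rewrite /avg -rintZ// -rintD//; last first.
    by move=> s; apply: cvgZl_tmp; exact: ck.
  congr rint; apply/funext => s; rewrite /tangent /=.
  rewrite (_ : (a *: k1 + k2).1 + s *: (a *: k1 + k2).2 =
    a *: (k1.1 + s *: k1.2) + (k2.1 + s *: k2.2)) ?linearP//.
  by rewrite /= !scalerDr addrACA.
- move=> k; apply: (@cvg_comp _ _ _ (fun k => interchange (z, k)) (avg (tangent h)) _
    (nbhs ((z.1, k.1), (z.2, k.2)))); last exact: avg_continuous.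
  apply: (@cvg_pair _ _ _ _ (nbhs (z.1, k.1)) (nbhs (z.2, k.2))).
    by apply: cvg_pair; [exact: cvg_cst|exact: cvg_fst].
  by apply: cvg_pair; [exact: cvg_cst|exact: cvg_snd].
move=> e e0.
(* The increment [k.1 + s k.2] has norm at most [2 |k|], and [2 e / 3] is below [e]. *)
have e3 : 0 < e / 3 by rewrite divr_gt0.
have : \forall k \near (0 : V * V), forall s : R, 0 <= s <= 1 ->
  let p := z.1 + s *: z.2 in let d := k.1 + s *: k.2 in
  `|h (p + d) - h p - 'd h p d| <= e / 3 * `|d|.
  apply: (@near_unit_segment _ _ (nbhs (0 : V * V)) (fun k s =>
    let p := z.1 + s *: z.2 in let d := k.1 + s *: k.2 in
    `|h (p + d) - h p - 'd h p d| <= e / 3 * `|d|)) => s s01.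
  have := Ck2_strict_diff (z.1 + s *: z.2) Ch e3.
  pose Q (x : V * V) := `|h (x.1 + x.2) - h x.1 - 'd h (x.1) (x.2)| <= e / 3 * `|x.2|.
  move=> H.
  have HQ : \forall x \near (z.1 + s *: z.2, 0 : V), Q x by exact: H.
  have cd : (fun q : R * (V * V) => q.2.1 + q.1 *: q.2.2) q
      @[q --> (s, 0 : V * V)] --> (0 : V).
    have E : 0 = (0 : V * V).1 + s *: (0 : V * V).2 by rewrite scaler0 addr0.
    by rewrite [X in _ --> X]E; exact: (@segment_continuous _ (s, 0)).
  have cm : (fun q : R * (V * V) => (z.1 + q.1 *: z.2, q.2.1 + q.1 *: q.2.2)) q
      @[q --> (s, 0 : V * V)] --> (z.1 + s *: z.2, 0 : V).
    apply: cvg_pair.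
      apply: cvgD; first exact: cvg_cst.
      by apply: cvgZr_tmp; exact: cvg_fst.
    exact: cd.
  exact: (cm _ HQ).
apply: filterS => k H.
have c1 := @line_continuous _ _ h (z + k) ch; have c2 := @line_continuous _ _ h z ch.
rewrite /avg -rintB// -rintB//; last by move=> s; apply: cvgB; [exact: c1|exact: c2].
apply: rint_norm => [s|s s01].
  by apply: cvgB; [apply: cvgB; [exact: c1|exact: c2]|exact: ck].
have := H s s01; rewrite /= /tangent /=.
have -> : z.1 + k.1 + s *: (z.2 + k.2) = z.1 + s *: z.2 + (k.1 + s *: k.2).
  by rewrite scalerDr addrACA.
move=> /le_trans; apply.
have /andP[s0 s1] := s01.
set nk : R := `|k : ((V * V)%type : normedModType R)|.
have nkE : nk = Num.max `|k.1| `|k.2| by [].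
have k1 : `|k.1| <= nk by rewrite nkE le_max lexx.
have k2 : `|k.2| <= nk by rewrite nkE le_max lexx orbT.
rewrite mulrAC ler_pdivrMr// -mulrA ler_pM2l//.
apply: le_trans (ler_normD _ _) _; rewrite normrZ ger0_norm//.
apply: (@le_trans _ _ (nk + nk)); last by have nk0 : 0 <= nk := normr_ge0 _; lra.
by rewrite lerD// (le_trans _ k2)// ler_piMl.
Qed.

End AverageDifferential.

(** The tangent of an average is an average of the tangent map, up to [interchange], hence the
    induction. The two extra orders pay for [Ck2_strict_diff] at each stage and cost nothing for
    smooth maps. *)
Lemma Ck_avg k (V : normedModType R) (W : completeNormedModType R) (h : V -> W) :
  Ck k.+2 setT h -> Ck k setT (avg h).
Proof.
elim: k V W h => [|k IH] V W h Ch.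
  by apply/Ck0/avg_continuous/Ck0/CkW/CkW.
have C2 : Ck 2 setT h by elim: (k) (Ch) => [|j IHj] /CkW.
apply/CkS; split=> [z|]; first by have := avg_is_diff z C2 => ?; exact: ex_diff.
rewrite (_ : tangent _ = avg (tangent h) \o (@interchange V)); last first.
  by apply/funext => -[z w]; have := avg_is_diff z C2 => ?; rewrite /tangent/= diff_val.
apply: Ck_comp; last by have /CkS[_ /IH] := Ch.
have c1 := @Ck_fst R k; have c2 := @Ck_snd R k.
rewrite /interchange; apply: Ck_pair; apply: Ck_pair.
- exact: (Ck_comp (c1 _ _) (c1 _ _)).
- exact: (Ck_comp (c2 _ _) (c1 _ _)).
- exact: (Ck_comp (c1 _ _) (c2 _ _)).
- exact: (Ck_comp (c2 _ _) (c2 _ _)).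
Qed.

Lemma smooth_avg (V : normedModType R) (W : completeNormedModType R) (h : V -> W) :
  smooth h -> smooth (avg h).
Proof. by move=> sh k; exact: Ck_avg. Qed.

Lemma rint_cst (W : completeNormedModType R) (w : W) : rint (fun=> w) = w.
Proof.
rewrite (@rint_ftc _ _ (fun s => s *: w)) ?scale1r ?scale0r ?subr0//.
- by move=> s; exact: cvg_cst.
- by move=> t; rewrite (@diff_val _ _ _ _ _ _ _ (is_diff_scalel t w)) scale1r.
Qed.

Section DifferenceQuotient.
Variables (V : normedModType R) (W : completeNormedModType R) (h : V -> W).
Hypothesis sh : smooth h.

(** Hadamard's integral form of [(h (x + e v) - h x) / e], which stays smooth at [e = 0]. The
    increment [(e v, 0)] moves the base point and keeps the direction [v]. *)
Definition difference_quotient (w : V * V * R) : W :=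
  avg (tangent h) ((w.1.1, w.1.2), (w.2 *: w.1.2, 0)).

Lemma smooth_difference_quotient : smooth difference_quotient.
Proof.
have sa := smooth_avg (smooth_tangent sh) => k.
have c1 := @Ck_fst R k; have c2 := @Ck_snd R k.
apply: (Ck_comp _ (sa k)); apply: Ck_pair.
  by apply: Ck_pair; [exact: (Ck_comp (c1 _ _) (c1 _ _))
                     |exact: (Ck_comp (c1 _ _) (c2 _ _))].
apply: Ck_pair; last exact: Ck_cst.
by apply: Ck_scale; [exact: c2|exact: (Ck_comp (c1 _ _) (c2 _ _))].
Qed.

Lemma difference_quotient0 x v : difference_quotient (x, v, 0) = 'd h x v.
Proof.
rewrite /difference_quotient /avg -[RHS]rint_cst; congr rint.
by apply/funext => s; rewrite /tangent /= !scale0r !scaler0 !addr0.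
Qed.

(** The integrand times [e] is the derivative of [s |-> h (x + s e v)]. *)
Lemma difference_quotientE x v e :
  e *: difference_quotient (x, v, e) = h (x + e *: v) - h x.
Proof.
have th := smooth_tangent sh.
rewrite /difference_quotient /avg -rintZ; last first.
  by apply: line_continuous; apply/Ck0; exact: th.
rewrite (rint_ftc (c := fun s => h (x + s *: (e *: v)))).
- by rewrite scale1r scale0r addr0.
- move=> s; apply: cvgZl_tmp.
  by apply: line_continuous; apply/Ck0; exact: th.
- by move=> t; apply: line_differentiable; exact: smooth_differentiable.
- move=> t; rewrite line_diff; last exact: smooth_differentiable.
  by rewrite /tangent/= scaler0 addr0 linearZ.
Qed.

End DifferenceQuotient.

End Average.

(** * Tangent functoriality *)

Section TangentFunctoriality.
Variables (R : realType) (Phi : integrator R).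
Hypothesis Phi_regular : regular_integrator Phi.
Hypothesis Phi_affine : affine_equivariant Phi.

Lemma affine_equivariant_linear (Y U : completeNormedModType R) (L : Y -> U)
    (b : U) (f : Y -> Y) (g : U -> U) (y : Y) :
  linear L -> continuous L -> smooth f -> smooth g ->
  (forall y, L (f y) = g (L y + b)) ->
  Phi g (L y + b) = L (Phi f y) + b.
Proof.
move=> lL cL sf sg E.
pose L' : {linear Y -> U} := HB.pack L (GRing.isLinear.Build _ _ _ _ _ lL).
by rewrite -(Phi_affine (L := L') cL sf sg E).
Qed.

(** A projection is affine, so a component whose field is autonomous is integrated by itself. *)
Lemma equivariant_fst (Y U : completeNormedModType R) (F : Y * U -> Y * U)
    (f : Y -> Y) z :
  smooth F -> smooth f -> (forall z, (F z).1 = f z.1) ->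
  (Phi F z).1 = Phi f z.1.
Proof.
move=> sF sf E; rewrite -[LHS]addr0 -[z.1 in RHS]addr0.
rewrite (affine_equivariant_linear (L := fst) _ _ _ sF)//.
  by move=> w; exact: cvg_fst.
by move=> w; rewrite addr0.
Qed.

Lemma equivariant_snd (Y U : completeNormedModType R) (F : Y * U -> Y * U)
    (f : U -> U) z :
  smooth F -> smooth f -> (forall z, (F z).2 = f z.2) ->
  (Phi F z).2 = Phi f z.2.
Proof.
move=> sF sf E; rewrite -[LHS]addr0 -[z.2 in RHS]addr0.
rewrite (affine_equivariant_linear (L := snd) _ _ _ sF)//.
  by move=> w; exact: cvg_snd.
by move=> w; rewrite addr0.
Qed.

Variables (Y : completeNormedModType R) (f : Y -> Y).
Hypothesis sf : smooth f.

Definition tangent_field (z : Y * Y) : Y * Y := (f z.1, 'd f (z.1) (z.2)).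

Lemma smooth_tangent_field : smooth tangent_field.
Proof.
move=> k; apply: Ck_pair; last exact: smooth_tangent.
exact: (Ck_comp (@Ck_fst R k _ _) (sf k)).
Qed.

Definition product_field (z : Y * Y) : Y * Y := (f z.1, f z.2).

Lemma smooth_product_field : smooth product_field.
Proof.
move=> k; apply: Ck_pair.
  exact: (Ck_comp (@Ck_fst R k _ _) (sf k)).
exact: (Ck_comp (@Ck_snd R k _ _) (sf k)).
Qed.

Lemma product_fieldE z : Phi product_field z = (Phi f z.1, Phi f z.2).
Proof.
rewrite [LHS]surjective_pairing; congr pair.
  by apply: equivariant_fst => //; exact: smooth_product_field.
by apply: equivariant_snd => //; exact: smooth_product_field.
Qed.

(* The step [e] is a state variable: continuity of the integrator in [e] is
   then part of its regularity. *)
Definition quotient_field (w : Y * Y * R) : Y * Y * R :=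
  (f w.1.1, difference_quotient f w, 0).

Lemma smooth_quotient_field : smooth quotient_field.
Proof.
move=> k; have c1 := @Ck_fst R k.
apply: Ck_pair; last exact: Ck_cst.
apply: Ck_pair; last exact: smooth_difference_quotient.
exact: (Ck_comp (Ck_comp (c1 _ _) (c1 _ _)) (sf k)).
Qed.

(** The inclusion [z |-> (z, 0)] relates the two fields, since the quotient at step 0 is the
    differential. *)
Lemma quotient_field0 x xi :
  Phi quotient_field (x, xi, 0) = (Phi tangent_field (x, xi), 0).
Proof.
have := @affine_equivariant_linear _ _ (fun z : Y * Y => (z, 0 : R)) 0
  tangent_field quotient_field (x, xi).
rewrite !addr0; apply.
- by move=> a u v; congr pair; rewrite /= scaler0 addr0.
- by apply: continuous_pair => z; [exact: cvg_id|exact: cvg_cst].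
- exact: smooth_tangent_field.
- exact: smooth_quotient_field.
- move=> [y v]; rewrite addr0 /quotient_field /tangent_field /=.
  by rewrite difference_quotient0.
Qed.

(** For fixed [e] the affine map [(x, x') |-> (x, (x' - x) / e, e)] relates [product_field] to
    [quotient_field]; it is split into its linear part [L] and the translation by [(0, 0, e)]. *)
Lemma quotient_fieldE x xi e : e != 0 ->
  Phi quotient_field (x, xi, e) =
  (Phi f x, e^-1 *: (Phi f (x + e *: xi) - Phi f x), e).
Proof.
move=> e0.
pose L (z : Y * Y) : Y * Y * R := (z.1, e^-1 *: (z.2 - z.1), 0).
have LE z : L z + (0, 0, e) = (z.1, e^-1 *: (z.2 - z.1), e).
  by congr (_, _, _); rewrite /= ?addr0 ?add0r.
have -> : (x, xi, e) = L (x, x + e *: xi) + (0, 0, e).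
  by rewrite LE /= [x + _]addrC addrK scalerA mulVf// scale1r.
rewrite (affine_equivariant_linear (L := L) (f := product_field)).
- by rewrite product_fieldE LE.
- move=> a u v; congr (_, _, _) => /=; last by rewrite scaler0 addr0.
  by rewrite opprD addrACA -scalerBr scalerDr !scalerA mulrC.
- apply: continuous_pair; last by move=> z; exact: cvg_cst.
  apply: continuous_pair => z; first exact: cvg_fst.
  by apply: cvgZl_tmp; apply: cvgB; [exact: cvg_snd|exact: cvg_fst].
- exact: smooth_product_field.
- exact: smooth_quotient_field.
move=> z; rewrite LE /quotient_field /=; congr (_, _, _) => /=.
apply: (scalerI e0); rewrite difference_quotientE//.
by rewrite !scalerA divff// !scale1r [_ + (_ - _)]addrC subrK.
Qed.

(** Both tangent components are the limit, as [e] tends to 0, of the middle component of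
    [Phi quotient_field (x, xi, e)]: on the left by continuity at [e = 0], on the right because it
    is a difference quotient of [Phi f]. *)
Lemma tangent_fieldE x xi :
  Phi tangent_field (x, xi) = (Phi f x, 'd (Phi f) x xi).
Proof.
have dPhi : differentiable (Phi f) x by exact: Phi_regular.
(* The neighbourhood is punctured since [quotient_fieldE] needs [e != 0], and so is the one in the
   definition of the derivative. *)
have cE : (fun e => Phi quotient_field (x, xi, e)) e @[e --> (0 : R)^'] -->
    (Phi tangent_field (x, xi), 0 : R).
  rewrite -quotient_field0.
  have c0 : (fun e => Phi quotient_field (x, xi, e)) e @[e --> (0 : R)] -->
      Phi quotient_field (x, xi, 0).
    apply: (@cvg_comp _ _ _ (fun e : R => (x, xi, e)) (@Phi _ quotient_field) _
        (nbhs (x, xi, 0 : R))).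
      by apply: (@continuous_pair _ _ _ _ (fun=> (x, xi)) id) => ?;
        [exact: cvg_cst|exact: cvg_id].
    have := Phi_regular smooth_quotient_field (x, xi, 0).
    by move=> /differentiable_continuous.
  exact: cvg_trans (cvg_app _ (@nbhs_dnbhs _ (0 : R))) c0.
rewrite [LHS]surjective_pairing; congr pair.
  apply: (@equivariant_fst _ _ _ f (x, xi)) => //; exact: smooth_tangent_field.
rewrite -deriveE// /derive.
have c2 : (Phi quotient_field (x, xi, e)).1.2 @[e --> (0 : R)^'] -->
    (Phi tangent_field (x, xi)).2.
  have cs : continuous (fun w : Y * Y * R => w.1.2).
    by apply/Ck0; exact: (Ck_comp (@Ck_fst R 0 _ _) (@Ck_snd R 0 _ _)).
  have := cs (Phi tangent_field (x, xi), 0).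
  exact: (cvg_comp _ _ cE).
symmetry; apply: cvg_lim; first exact: norm_hausdorff.
apply: cvg_trans c2; apply: near_eq_cvg.
near=> e.
have e0 : e != 0 by near: e; exact: nbhs_dnbhs_neq.
by rewrite quotient_fieldE//= [x + _]addrC.
Unshelve. all: by end_near. Qed.

End TangentFunctoriality.

(** * Symmetry of second derivatives *)

Section SecondDerivative.
Variables (R : realType) (V W : normedModType R) (H : V -> W) (U : set V).
Hypothesis U_open : open U.
Hypothesis dH : forall y, U y -> differentiable H y.

Definition second_difference (q h k : V) : W :=
  H (q + k + h) - H (q + h) - (H (q + k) - H q).

(* Mean value inequality for [t |-> H (q + s k + t h) - H (q + t h)], whose
   derivative is [s D_k D_h H (q) + o(s)] for [0 <= t <= s]. *)
Lemma second_difference_near (q h k : V) (e : R) : U q ->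
  differentiable (fun q' => 'd H q' h) q -> 0 < e ->
  exists2 d : R, 0 < d & forall s, 0 < s -> s < d ->
    `|second_difference q (s *: h) (s *: k)
      - s ^+ 2 *: 'd (fun q' => 'd H q' h) q k| <= e * s ^+ 2.
Proof.
move=> Uq dDh e0.
(* The remainder is estimated at [s k + t h] and at [t h], whose norms add up to at most
   [s (|k| + 2 |h|)]; the summand 1 makes [N] positive. *)
pose N := `|k| + `|h| + `|h| + 1.
have N0 : 0 < N by rewrite ltr_wpDl// !addr_ge0.
have eN : 0 < e / N by rewrite divr_gt0.
have /nbhs_ballP[r r0 Hr] := diff_near dDh eN.
have /nbhs_ballP[r' r0' Ur] : nbhs q U by exact: open_nbhs_nbhs.
exists (Num.min r r' / N) => [|s s0 sd].
  by rewrite divr_gt0// lt_min r0.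
have sN : s * N < Num.min r r' by rewrite -ltr_pdivlMr.
have sr v : `|v| <= s * N -> `|v| < r.
  by move=> /le_lt_trans /(_ sN); rewrite lt_min => /andP[].
have sr' v : `|v| <= s * N -> U (q + v).
  move=> vN; apply: Ur; rewrite -ball_normE/= opprD addrA subrr sub0r normrN.
  by move: (le_lt_trans vN sN); rewrite lt_min => /andP[].
have small t : 0 <= t -> t <= s ->
    `|t *: h| <= s * `|h| /\ `|s *: k + t *: h| <= s * `|k| + s * `|h|.
  move=> t0 ts; have th : `|t *: h| <= s * `|h|.
    by rewrite normrZ ger0_norm// ler_wpM2r.
  split=> //; apply: le_trans (ler_normD _ _) _.
  by rewrite lerD// normrZ gtr0_norm.
have sh0 : 0 <= s * `|h| by rewrite mulr_ge0// ltW.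
have sk0 : 0 <= s * `|k| by rewrite mulr_ge0// ltW.
have NE : s * N = s * `|k| + s * `|h| + s * `|h| + s by rewrite !mulrDr mulr1.
pose D h' := fun q' => 'd H q' h'.
pose L := 'd (D h) q.
pose c (t : R) := H (q + s *: k + t *: h) - H (q + t *: h) - t *: L (s *: k).
have c_diff (t : R) : 0 <= t <= s ->
    is_diff t c (('d (fun t : R => H (q + s *: k + t *: h)) t : R -> W)
      - ('d (fun t : R => H (q + t *: h)) t : R -> W)
      - (fun t : R => t *: L (s *: k))).
  move=> /andP[t0 ts]; have [s1 s2] := small t t0 ts.
  have d1 : differentiable H (q + s *: k + t *: h).
    by apply: dH; rewrite -addrA; apply: sr'; apply: le_trans s2 _; rewrite NE; lra.
  have d2 : differentiable H (q + t *: h).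
    by apply: dH; apply: sr'; apply: le_trans s1 _; rewrite NE; lra.
  exact: (is_diffB (is_diffB (differentiableP (line_differentiable d1))
    (differentiableP (line_differentiable d2))) (is_diff_scalel t (L (s *: k)))).
have : `|c s - c 0| <= e * s * (s - 0).
  apply: mvt_le => [|t t01|t t01]; first exact: ltW.
    by have := c_diff t t01 => ?.
  have cd := c_diff t t01.
  have /andP[t0 ts] := t01; have [s1 s2] := small t t0 ts.
  have U1 : U (q + s *: k + t *: h).
    by rewrite -addrA; apply: sr'; apply: le_trans s2 _; rewrite NE; lra.
  have U2 : U (q + t *: h) by apply: sr'; apply: le_trans s1 _; rewrite NE; lra.
  rewrite diff_val !fctE !line_diff; [|exact: dH..].
  rewrite scale1r.
  have b1 : ball (0 : V) r (s *: k + t *: h).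
    rewrite -ball_normE/= sub0r normrN; apply: sr.
    by apply: le_trans s2 _; rewrite NE; lra.
  have b2 : ball (0 : V) r (t *: h).
    rewrite -ball_normE/= sub0r normrN; apply: sr.
    by apply: le_trans s1 _; rewrite NE; lra.
  have := Hr _ b1; have := Hr _ b2; rewrite /= -/(D h) -/L => h2 h1.
  have -> : 'd H (q + s *: k + t *: h) h - 'd H (q + t *: h) h - L (s *: k) =
     ('d H (q + (s *: k + t *: h)) h - 'd H q h - L (s *: k + t *: h)) -
     ('d H (q + t *: h) h - 'd H q h - L (t *: h)).
    rewrite linearD [q + (_ + _)]addrA.
    rewrite [in RHS]opprD [in RHS]opprB !addrA [in RHS]subrK.
    by rewrite [RHS]addrAC [in RHS]opprB subrKA.
  apply: le_trans (ler_normB _ _) _; apply: le_trans (lerD h1 h2) _.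
  rewrite -mulrDr mulrAC ler_pdivrMr// -mulrA ler_pM2l//.
  by apply: le_trans (lerD s2 s1) _; rewrite NE; lra.
rewrite subr0 -mulrA -expr2; congr (`|_| <= _).
rewrite /c /second_difference !scale0r !addr0 subr0.
have -> : L (s *: k) = s *: L k by exact: linearZ.
by rewrite addrAC scalerA -expr2.
Qed.

End SecondDerivative.

Section Schwarz.
Variables (R : realType) (V W : normedModType R).

Lemma second_differenceC (H : V -> W) (q h k : V) :
  second_difference H q h k = second_difference H q k h.
Proof.
rewrite /second_difference !opprB ![_ + (H q - _)]addrA.
rewrite (addrAC q k h) [LHS]addrAC [RHS]addrAC; congr (_ + _).
by rewrite [LHS]addrAC.
Qed.

Lemma tangent_slice_differentiable (H : V -> W) (q h : V) :
  differentiable (tangent H) (q, h) -> differentiable (fun q' => 'd H q' h) q.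
Proof.
by move=> dT; apply: (@differentiable_comp _ _ _ _ (fun q' => (q', h)) (tangent H)).
Qed.

(** The second difference is symmetric in [h] and [k], and divided by [s ^+ 2] it approximates both
    mixed derivatives, each within [e / 2] for small [s]. *)
Lemma second_derivative_sym (H : V -> W) (U : set V) (q h k : V) :
  open U -> Ck 2 U H -> U q ->
  'd (fun q' => 'd H q' h) q k = 'd (fun q' => 'd H q' k) q h.
Proof.
move=> oU [dH [dT _]] Uq.
have dD l : differentiable (fun q' => 'd H q' l) q.
  by apply: tangent_slice_differentiable; apply: dT.
apply/eqP; rewrite -subr_eq0 -normr_le0; apply/ler_addgt0Pr => e e0.
have e2 : 0 < e / 2 by rewrite divr_gt0.
have [d1 d10 H1] := second_difference_near oU dH k Uq (dD h) e2.
have [d2 d20 H2] := second_difference_near oU dH h Uq (dD k) e2.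
pose s := Num.min d1 d2 / 2.
have m0 : 0 < Num.min d1 d2 by rewrite lt_min d10.
have s0 : 0 < s by rewrite divr_gt0.
have sm : s < Num.min d1 d2 by rewrite ltr_pdivrMr// ltr_pMr// ltr1n.
move: sm; rewrite lt_min => /andP[sd1 sd2].
have := H1 s s0 sd1; have := H2 s s0 sd2.
rewrite (second_differenceC _ _ (s *: k)).
set S := second_difference _ _ _ _ => {}H2 {}H1.
have ss : 0 < s ^+ 2 by rewrite exprn_gt0.
rewrite add0r -(ler_pM2l ss) -[X in X * `|_|]gtr0_norm// -normrZ scalerBr.
rewrite -[X in `|X|](subrKA S).
apply: le_trans (ler_normD _ _) _; rewrite distrC.
apply: le_trans (lerD H1 H2) _; lra.
Qed.

End Schwarz.

(** * Continuity of directional derivatives *)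

Section DirectionalDerivative.
Variable R : realType.

Lemma linear_limit (S W : normedModType R) (T_ : nat -> S -> W) (T : S -> W) :
  (forall n, linear (T_ n)) -> (forall s, T_ n s @[n --> \oo] --> T s) ->
  linear T.
Proof.
move=> lT cT a u v.
have c1 := cT (a *: u + v).
have c2 : T_ n (a *: u + v) @[n --> \oo] --> a *: T u + T v.
  rewrite (_ : (fun n => _) = fun n => a *: T_ n u + T_ n v); last first.
    by apply/funext => n; rewrite lT.
  by apply: cvgD => //; apply: cvgZl_tmp.
by rewrite -(cvg_lim (@norm_hausdorff _ _) c1) -(cvg_lim (@norm_hausdorff _ _) c2).
Qed.

(** A pointwise convergent sequence is pointwise bounded, hence by Banach--Steinhaus uniformly
    bounded on the unit ball, and the bound passes to the limit. *)
Lemma continuous_limit (S : completeNormedModType R) (W : normedModType R)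
    (T_ : nat -> S -> W) (T : S -> W) :
  (forall n, linear (T_ n)) -> (forall n, continuous (T_ n)) ->
  (forall s, T_ n s @[n --> \oo] --> T s) -> continuous T.
Proof.
move=> lT cT limT.
have bounded n : bounded_fun_norm (T_ n).
  pose L : {linear S -> W} := HB.pack (T_ n) (GRing.isLinear.Build _ _ _ _ _ (lT n)).
  have [k k0 kL] := @linear_lipschitz _ _ _ L (cT n).
  move=> r; exists (k * r) => s sr; apply: le_trans (kL s) _.
  by rewrite ler_wpM2l// ltW.
have [|s|M HM] := @Banach_Steinhauss _ _ _ (range T_) _ _ 1.
- by move=> _ [n _ <-].
- have /cvg_seq_bounded [M [Mr bM]] : cvg (T_ n s @[n --> \oo]).
    by apply/cvg_ex; exists (T s).
  (* The boundedness at hand speaks of constants strictly above [M]. *)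
  exists (M + 1) => _ [n _ <-].
  by apply: bM; rewrite // ltrDl.
have TM s : `|s| <= 1 -> `|T s| <= M.
  move=> s1; have cn : `|T_ n s| @[n --> \oo] --> `|T s| by exact: cvg_norm.
  rewrite -(cvg_lim (@norm_hausdorff _ _) cn); apply: limr_le.
    by apply/cvg_ex; exists `|T s|.
  by apply: nearW => n; apply: HM => //; exists n.
pose L : {linear S -> W} := HB.pack T (GRing.isLinear.Build _ _ _ _ _
  (linear_limit lT limT)).
apply: (@bounded_linear_continuous _ _ _ L).
apply/ex_bound; exists M; apply/nbhs_norm0P; exists 1 => //= s /=.
by move=> /ltW/TM.
Qed.

(** The derivative at [x] is a pointwise limit of quotients built from two evaluations, each linear
    and continuous in [s], so that [continuous_limit] applies. *)
Lemma derive_functional (S : completeNormedModType R) (X W : normedModType R)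
    (Omega : set X) (T : S -> X -> W) (x v : X) :
  open Omega -> Omega x ->
  (forall x, Omega x -> linear (T ^~ x)) ->
  (forall x, Omega x -> continuous (T ^~ x)) ->
  (forall s, derivable (T s) x v) ->
  linear (fun s => 'D_v (T s) x) /\ continuous (fun s => 'D_v (T s) x).
Proof.
move=> oO Ox lT cT dT.
have /nbhs_ballP[d d0 Hd] : \forall h \near (0 : R), Omega (h *: v + x).
  have : (fun h : R => h *: v + x) @ 0 --> x.
    rewrite -[X in _ --> X]add0r -[X in _ --> X + _](scale0r v).
    by apply: cvgD; [apply: cvgZr_tmp; exact: cvg_id|exact: cvg_cst].
  by apply; exact: open_nbhs_nbhs.
(* The factor [d / 2] keeps every [h_ n *: v + x] inside [Omega], where evaluation is known to be
   linear and continuous. *)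
pose h_ (n : nat) : R := d / 2 * n.+1%:R^-1.
have h0 n : h_ n != 0 by rewrite !mulf_neq0// ?gt_eqF// invr_gt0.
have h_lim : h_ @ \oo --> (0 : R).
  rewrite -(mulr0 (d / 2)); apply: cvgM; [exact: cvg_cst|exact: cvg_harmonic].
have Oh n : Omega (h_ n *: v + x).
  apply: Hd; rewrite -ball_normE/= sub0r normrN ger0_norm; last first.
    by rewrite !mulr_ge0 ?invr_ge0// (ltW d0).
  rewrite (@le_lt_trans _ _ (d / 2))//; last by rewrite ltr_pdivrMr// ltr_pMr// ltr1n.
  by rewrite ler_piMr ?divr_ge0 ?(ltW d0)// invf_le1// ler1n.
have h_dlim : h_ @ \oo --> (0 : R)^'.
  move=> A /h_lim hA.
  have {}hA : \forall n \near \oo, h_ n != 0 -> A (h_ n) by exact: hA.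
  change (\forall n \near \oo, A (h_ n)).
  by apply: filterS hA => n; apply; exact: h0.
pose T_ n s := (h_ n)^-1 *: (T s (h_ n *: v + x) - T s x).
have limT s : T_ n s @[n --> \oo] --> 'D_v (T s) x.
  exact: (cvg_comp _ _ h_dlim (dT s)).
have linT n : linear (T_ n).
  move=> a u w; rewrite /T_ (lT _ (Oh n)) (lT _ Ox).
  by rewrite opprD addrACA -scalerBr scalerDr !scalerA mulrC.
split; first exact: linear_limit limT.
apply: continuous_limit limT => // n s.
apply: cvgZl_tmp; apply: cvgB; [exact: (cT _ (Oh n))|exact: (cT _ Ox)].
Qed.

End DirectionalDerivative.

(** * Multisymplectic conservation law *)

Section LinearDifferential.
Variable R : realType.

Lemma linear_is_diff (V W : normedModType R) (L : V -> W) (y : V) :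
  linear L -> continuous L -> is_diff y L L.
Proof.
move=> lL cL.
pose L' : {linear V -> W} := HB.pack L (GRing.isLinear.Build _ _ _ _ _ lL).
apply: DiffDef; first exact: (@linear_differentiable _ _ _ L').
exact: (@diff_lin _ _ _ L').
Qed.

Lemma diff_linear_comp (U V W : normedModType R) (L : V -> W) (F : U -> V)
    (y xi : U) : linear L -> continuous L -> differentiable F y ->
  'd (L \o F) y xi = L ('d F y xi).
Proof.
move=> lL cL dF; have H := linear_is_diff (F y) lL cL.
by rewrite (diff_comp dF)//= diff_val.
Qed.

End LinearDifferential.

Section FieldEquations.
Variables (R : realType) (m n : nat) (Omega : set 'rV[R]_m).
Variables (H : 'rV[R]_m -> phase R m n -> R) (dom : 'rV[R]_m -> set (phase R m n)).
Hypothesis Omega_open : open Omega.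
Hypothesis dom_open : forall x, Omega x -> open (dom x).
Hypothesis H_C2 : forall x, Omega x -> Ck 2 (dom x) (H x).
Variables (Y S : completeNormedModType R).
Variables (evY : Y -> 'rV[R]_m -> ('rV[R]_n * 'rV[R]_n)%type)
  (evS : S -> 'rV[R]_m -> 'M[R]_(n, m)).
Hypothesis Y_space : function_space Omega evY.
Hypothesis S_space : function_space Omega evS.
Hypothesis Y_cont : continuous_evaluation Omega evY.
Hypothesis S_cont : continuous_evaluation Omega evS.
Hypothesis Y_deriv : forall (y : Y) x (i : 'I_n) (mu : 'I_m), Omega x ->
  derivable (fun x' => (evY y x').1 0 i) x (delta_mx 0 mu).
Hypothesis S_deriv : forall (s : S) x (i : 'I_n) (mu : 'I_m), Omega x ->
  derivable (fun x' => evS s x' i mu) x (delta_mx 0 mu).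
Variables (sigma : Y -> S) (f : Y -> Y).
Hypothesis sigma_diff : forall y, differentiable sigma y.
Hypothesis f_diff : forall y, differentiable f y.
Hypothesis f_dDW : written_as_ode Omega H dom evY evS f sigma.

Definition dir_u i : phase R m n := (delta_mx 0 i, 0, 0).
Definition dir_p i : phase R m n := (0, delta_mx 0 i, 0).
Definition dir_sigma i mu : phase R m n := (0, 0, delta_mx i mu).

Definition point (y : Y) x : phase R m n :=
  ((evY y x).1, (evY y x).2, evS (sigma y) x).

Lemma linear_u x i : Omega x -> linear (fun y => (evY y x).1 0 i).
Proof. by move=> Ox a u v; rewrite (Y_space.1 x Ox) !mxE. Qed.

Lemma linear_p x i : Omega x -> linear (fun y => (evY y x).2 0 i).
Proof. by move=> Ox a u v; rewrite (Y_space.1 x Ox) !mxE. Qed.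

Lemma linear_sigma x i mu : Omega x -> linear (fun s => evS s x i mu).
Proof. by move=> Ox a u v; rewrite (S_space.1 x Ox) !mxE. Qed.

Lemma continuous_u_row x : Omega x -> continuous (fun y => (evY y x).1).
Proof.
move=> Ox y.
exact: (cvg_comp _ _ (@Y_cont x Ox y) (@cvg_fst _ _ (nbhs (evY y x).1) (nbhs (evY y x).2) _)).
Qed.

Lemma continuous_p_row x : Omega x -> continuous (fun y => (evY y x).2).
Proof.
move=> Ox y.
exact: (cvg_comp _ _ (@Y_cont x Ox y) (@cvg_snd _ _ (nbhs (evY y x).1) (nbhs (evY y x).2) _)).
Qed.

Lemma continuous_u x i : Omega x -> continuous (fun y => (evY y x).1 0 i).
Proof.
move=> Ox y; exact: (@continuous_comp _ _ _ (fun y => (evY y x).1)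
  (fun M : 'rV[R]_n => M 0 i) y (@continuous_u_row x Ox y) (@coord_continuous _ _ _ 0 i _)).
Qed.

Lemma continuous_p x i : Omega x -> continuous (fun y => (evY y x).2 0 i).
Proof.
move=> Ox y; exact: (@continuous_comp _ _ _ (fun y => (evY y x).2)
  (fun M : 'rV[R]_n => M 0 i) y (@continuous_p_row x Ox y) (@coord_continuous _ _ _ 0 i _)).
Qed.

Lemma continuous_sigma x i mu : Omega x -> continuous (fun s => evS s x i mu).
Proof.
move=> Ox s; exact: (@continuous_comp _ _ _ (evS^~ x)
  (fun M : 'M[R]_(n, m) => M i mu) s (@S_cont x Ox s) (@coord_continuous _ _ _ i mu _)).
Qed.

Lemma point_is_diff y x : Omega x ->
  is_diff y (point^~ x) (fun xi => variation evY evS sigma y xi x).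
Proof.
move=> Ox.
have du : is_diff y (fun y => (evY y x).1) (fun y => (evY y x).1).
  apply: linear_is_diff; last exact: continuous_u_row.
  by move=> a u v; rewrite (Y_space.1 x Ox).
have dp : is_diff y (fun y => (evY y x).2) (fun y => (evY y x).2).
  apply: linear_is_diff; last exact: continuous_p_row.
  by move=> a u v; rewrite (Y_space.1 x Ox).
have ds : is_diff y (fun y => evS (sigma y) x) (fun xi => evS ('d sigma y xi) x).
  have d1 := linear_is_diff (sigma y) (S_space.1 x Ox) (S_cont Ox).
  exact: (is_diff_comp (differentiableP (sigma_diff y)) d1).
exact: (is_diff_pair (is_diff_pair du dp) ds).
Qed.

Lemma derive1_affine (V : normedModType R) (L : V -> R) (y v : V) :
  linear L -> derive1 (fun t : R => L (y + t *: v)) 0 = L v.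
Proof.
move=> lL.
have -> : (fun t : R => L (y + t *: v)) = fun t => L y + t *: L v.
  by apply/funext => t; rewrite addrC lL addrC.
rewrite derive1E'; last by have := line_is_diff (L y) (L v) 0 => ?.
by rewrite (@diff_val _ _ _ _ _ _ _ (line_is_diff (L y) (L v) 0)) scale1r.
Qed.

Lemma field_equations y x : Omega x ->
  dom x (point y x) /\ forall i : 'I_n,
  [/\ (evY (f y) x).1 0 i = 'd (H x) (point y x) (dir_p i),
      forall mu, partial mu (fun x' => (evY y x').1 0 i) x
                 = 'd (H x) (point y x) (dir_sigma i mu)
    & - ((evY (f y) x).2 0 i
         + \sum_(mu < m) partial mu (fun x' => evS (sigma y) x' i mu) x)
      = 'd (H x) (point y x) (dir_u i)].
Proof.
move=> Ox.
(* [written_as_ode] compares the two systems at one time only, so a line through [y] with velocity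
   [f y] can stand in for a solution. *)
pose c (t : R) := y + t *: f y.
have c0 : c 0 = y by rewrite /c scale0r addr0.
have dc : differentiable c 0 by have := line_is_diff y (f y) 0 => ?.
have dcE : derive1 c 0 = f (c 0).
  rewrite derive1E' // c0.
  by rewrite (@diff_val _ _ _ _ _ _ _ (line_is_diff y (f y) 0)) scale1r.
have [_ eqs] := @f_dDW c (sigma \o c) 0 (diff_derivable dc).
have {eqs} := eqs (conj dcE erefl) x Ox; rewrite /= c0 -/(point y x) => -[domx eqs].
split=> // i; have [e1 e2 e3] := eqs i.
have dHq : differentiable (H x) (point y x) by exact: (H_C2 Ox).1.
split.
- rewrite -(deriveE _ dHq) -[RHS]e1.
  by rewrite (derive1_affine y (f y) (linear_u i Ox)).
- by move=> mu; rewrite -(deriveE _ dHq) -[RHS]e2.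
rewrite -(deriveE _ dHq) -[RHS]e3.
by rewrite (derive1_affine y (f y) (linear_p i Ox)).
Qed.

Definition hess y x (e zeta : phase R m n) : R :=
  'd (fun q => 'd (H x) q e) (point y x) zeta.

Lemma diff_dH_point y x xi e : Omega x ->
  differentiable (fun y => 'd (H x) (point y x) e) y /\
  'd (fun y => 'd (H x) (point y x) e) y xi
  = hess y x e (variation evY evS sigma y xi x).
Proof.
move=> Ox; have dp := point_is_diff y Ox.
have dh : differentiable (fun q => 'd (H x) q e) (point y x).
  apply: tangent_slice_differentiable.
  by apply: (H_C2 Ox).2.1; split => //; exact: (field_equations y Ox).1.
have dpt : differentiable (point^~ x) y by exact: ex_diff.
split; first exact: (@differentiable_comp _ _ _ _ (point^~ x) (fun q => 'd (H x) q e)).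
rewrite -[LHS]/('d ((fun q => 'd (H x) q e) \o (point^~ x)) y xi).
by rewrite diff_comp//= diff_val.
Qed.

(** This follows from [derive_functional] and allows the derivative in [y] to pass through the
    divergence of [sigma y]. *)
Lemma linear_div_sigma x i : Omega x ->
  let D s := \sum_(mu < m) partial mu (fun x' => evS s x' i mu) x in
  linear D /\ continuous D.
Proof.
move=> Ox /=.
have D mu : linear (fun s => partial mu (fun x' => evS s x' i mu) x) /\
    continuous (fun s => partial mu (fun x' => evS s x' i mu) x).
  apply: (@derive_functional R S _ _ Omega (fun s x' => evS s x' i mu)) => //.
  - by move=> x' Ox'; exact: linear_sigma.
  - by move=> x' Ox'; exact: continuous_sigma.
  - by move=> s; exact: S_deriv.
split=> [a s t|].
  rewrite scaler_sumr -big_split/=; apply: eq_bigr => mu _.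
  by rewrite (D mu).1.
apply: continuous_big => [z|mu _]; last exact: (D mu).2.
exact: add_continuous.
Qed.

(** The field equations hold identically in [y], so both sides may be differentiated along [xi];
    their left sides are built from continuous linear functionals of [y], [f y] and [sigma y]. *)
Lemma linearized_equations y xi x : Omega x ->
  let zeta := variation evY evS sigma y xi x in
  forall i : 'I_n,
  [/\ (evY ('d f y xi) x).1 0 i = hess y x (dir_p i) zeta,
      forall mu, partial mu (fun x' => (evY xi x').1 0 i) x
                 = hess y x (dir_sigma i mu) zeta
    & - ((evY ('d f y xi) x).2 0 i
         + \sum_(mu < m) partial mu (fun x' => evS ('d sigma y xi) x' i mu) x)
      = hess y x (dir_u i) zeta].
Proof.
move=> Ox zeta i; rewrite /zeta.
have E y' := (field_equations y' Ox).2 i.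
have dF e := diff_dH_point y xi e Ox.
split.
- rewrite -(dF _).2 -(diff_linear_comp xi (linear_u i Ox) (@continuous_u x i Ox) (f_diff y)).
  congr ('d _ y xi); apply/funext => y'.
  by have [] := E y'.
- move=> mu; rewrite -(dF _).2.
  rewrite (_ : (fun y => _) = fun y => partial mu (fun x' => (evY y x').1 0 i) x); last first.
    by apply/funext => y'; have [_ ->] := E y'.
  have [l c] : linear (fun y => partial mu (fun x' => (evY y x').1 0 i) x) /\
      continuous (fun y => partial mu (fun x' => (evY y x').1 0 i) x).
    apply: (@derive_functional R Y _ _ Omega (fun y x' => (evY y x').1 0 i)) => //.
    + by move=> x' Ox'; exact: linear_u.
    + by move=> x' Ox'; exact: continuous_u.
    + by move=> y'; exact: Y_deriv.
  by rewrite (@diff_val _ _ _ _ _ _ _ (linear_is_diff y l c)).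
- have [lD cD] := linear_div_sigma i Ox.
  set D := (fun s => _) in lD cD.
  rewrite -(dF _).2.
  rewrite (_ : (fun y => _) =
    - (((fun y => (evY y x).2 0 i) \o f : Y -> R) + (D \o sigma : Y -> R))); last first.
    by apply/funext => y'; have [_ _ <-] := E y'.
  have d1 : differentiable ((fun y => (evY y x).2 0 i) \o f) y.
    apply: differentiable_comp; first exact: f_diff.
    exact: (@ex_diff _ _ _ _ _ _ _ (linear_is_diff (f y) (linear_p i Ox) (@continuous_p x i Ox))).
  have d2 : differentiable (D \o sigma) y.
    apply: differentiable_comp; first exact: sigma_diff.
    exact: (@ex_diff _ _ _ _ _ _ _ (linear_is_diff (sigma y) lD cD)).
  rewrite diffN; last exact: differentiableD.
  rewrite /= diffD//=; congr (- (_ + _)).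
    by rewrite (diff_linear_comp xi (linear_p i Ox) (@continuous_p x i Ox) (f_diff y)).
  by rewrite (diff_linear_comp xi lD cD (sigma_diff y)).
Qed.

Lemma phase_decomposition (L : {linear phase R m n -> R}) (z : phase R m n) :
  L z = \sum_(i < n) (z.1.1 0 i * L (dir_u i) + z.1.2 0 i * L (dir_p i)
    + \sum_(mu < m) z.2 i mu * L (dir_sigma i mu)).
Proof.
have E : z = \sum_(i < n) (z.1.1 0 i *: dir_u i + z.1.2 0 i *: dir_p i
    + \sum_(mu < m) z.2 i mu *: dir_sigma i mu).
  have s1 I (r : seq I) (F : I -> phase R m n) :
      \sum_(i <- r) F i = (\sum_(i <- r) (F i).1.1, \sum_(i <- r) (F i).1.2,
        \sum_(i <- r) (F i).2).
    elim: r => [|i r IH]; first by rewrite !big_nil.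
    by rewrite !big_cons IH.
  rewrite s1; case: z => [[u p] s] /=; congr (_, _, _).
  - rewrite [LHS]row_sum_delta; apply: eq_bigr => i _.
    by rewrite s1 /= scaler0 addr0 big1 ?addr0// => mu _; rewrite scaler0.
  - rewrite [LHS]row_sum_delta; apply: eq_bigr => i _.
    by rewrite s1 /= scaler0 add0r big1 ?addr0// => mu _; rewrite scaler0.
  - rewrite [LHS]matrix_sum_delta; apply: eq_bigr => i _.
    by rewrite s1 /= !scaler0 !add0r.
rewrite [in LHS]E linear_sum; apply: eq_bigr => i _.
rewrite !linearD !linearZ/= linear_sum; congr (_ + _).
by apply: eq_bigr => mu _; rewrite linearZ.
Qed.

Lemma hess_sym y x e zeta : Omega x -> hess y x e zeta = hess y x zeta e.
Proof.
move=> Ox; apply: (second_derivative_sym e zeta (dom_open Ox) (H_C2 Ox)).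
exact: (field_equations y Ox).1.
Qed.

Lemma partial_omega y xi eta x mu : Omega x ->
  partial mu (fun x' => omega mu (variation evY evS sigma y xi x')
                                 (variation evY evS sigma y eta x')) x
  = \sum_(i < n)
     (((evY xi x).1 0 i * partial mu (fun x' => evS ('d sigma y eta) x' i mu) x
       + evS ('d sigma y eta) x i mu * partial mu (fun x' => (evY xi x').1 0 i) x)
    - ((evY eta x).1 0 i * partial mu (fun x' => evS ('d sigma y xi) x' i mu) x
       + evS ('d sigma y xi) x i mu * partial mu (fun x' => (evY eta x').1 0 i) x)).
Proof.
move=> Ox; rewrite /partial.
pose G i := ((fun x' => (evY xi x').1 0 i) * (fun x' => evS ('d sigma y eta) x' i mu)
  - (fun x' => (evY eta x').1 0 i) * (fun x' => evS ('d sigma y xi) x' i mu)) : 'rV[R]_m -> R.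
have -> : (fun x' => omega mu (variation evY evS sigma y xi x')
    (variation evY evS sigma y eta x')) = \sum_(i < n) G i.
  by apply/funext => x'; rewrite fct_sumE.
have dM zeta zeta' i : derivable
   ((fun x' => (evY zeta x').1 0 i) * (fun x' => evS ('d sigma y zeta') x' i mu))
   x (delta_mx 0 mu).
  by apply: derivableM; [exact: Y_deriv|exact: S_deriv].
rewrite derive_sum; last by move=> i; exact: derivableB.
apply: eq_bigr => i _; rewrite deriveB//.
rewrite (deriveM (@Y_deriv xi x i mu Ox) (@S_deriv ('d sigma y eta) x i mu Ox)).
by rewrite (deriveM (@Y_deriv eta x i mu Ox) (@S_deriv ('d sigma y xi) x i mu Ox)).
Qed.

(** The symmetry of the Hessian between the two variations, expanded along the phase directions,
    becomes the conservation law once its coefficients are replaced by means of the linearised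
    equations. *)
Lemma multisymplectic_conservation y xi eta x : Omega x ->
  let var := variation evY evS sigma y in
  omega0 (var ('d f y xi) x) (var eta x) + omega0 (var xi x) (var ('d f y eta) x)
  = - \sum_(mu < m) partial mu (fun x' => omega mu (var xi x') (var eta x')) x.
Proof.
move=> Ox var.
have E1 := linearized_equations y xi Ox.
have E2 := linearized_equations y eta Ox.
have := hess_sym y (var eta x) (var xi x) Ox.
(* The linear structure of the differential sits in the second slot, so the expansion in the first
   goes through [hess_sym] and back. *)
have dec e z : hess y x e z = \sum_(i < n) (e.1.1 0 i * hess y x (dir_u i) z
    + e.1.2 0 i * hess y x (dir_p i) z
    + \sum_(mu < m) e.2 i mu * hess y x (dir_sigma i mu) z).
  rewrite hess_sym//.
  transitivity (\sum_(i < n) (e.1.1 0 i * hess y x z (dir_u i)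
    + e.1.2 0 i * hess y x z (dir_p i)
    + \sum_(mu < m) e.2 i mu * hess y x z (dir_sigma i mu))).
    exact: phase_decomposition.
  apply: eq_bigr => i _.
  rewrite (hess_sym y z (dir_u i) Ox) (hess_sym y z (dir_p i) Ox); congr (_ + _).
  by apply: eq_bigr => mu _; rewrite (hess_sym y z (dir_sigma i mu) Ox).
rewrite (dec (var eta x)) (dec (var xi x)) => /eqP; rewrite -subr_eq0 => /eqP E.
pose du zeta i mu := partial mu (fun x' => (evY zeta x').1 0 i) x.
pose ds zeta i mu := partial mu (fun x' => evS ('d sigma y zeta) x' i mu) x.
have -> : \sum_(mu < m) partial mu (fun x' => omega mu (var xi x') (var eta x')) x =
    \sum_(i < n) \sum_(mu < m)
     (((evY xi x).1 0 i * ds eta i mu + evS ('d sigma y eta) x i mu * du xi i mu)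
      - ((evY eta x).1 0 i * ds xi i mu + evS ('d sigma y xi) x i mu * du eta i mu)).
  by rewrite exchange_big; apply: eq_bigr => mu _; exact: partial_omega.
apply/eqP; rewrite -subr_eq0 opprK; apply/eqP.
(* With 0 written as the difference of the two Hessian expansions, the identity holds for each [i]
   separately. *)
rewrite -[RHS]E -sumrB /omega0 -!big_split /=.
apply: eq_bigr => i _.
have [p1 s1 u1] := E1 i; have [p2 s2 u2] := E2 i.
rewrite -/var in p1 s1 u1 p2 s2 u2.
have -> : \sum_(mu < m) evS ('d sigma y eta) x i mu * hess y x (dir_sigma i mu) (var xi x)
    = \sum_(mu < m) evS ('d sigma y eta) x i mu * du xi i mu.
  by apply: eq_bigr => mu _; rewrite -s1.
have -> : \sum_(mu < m) evS ('d sigma y xi) x i mu * hess y x (dir_sigma i mu) (var eta x)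
    = \sum_(mu < m) evS ('d sigma y xi) x i mu * du eta i mu.
  by apply: eq_bigr => mu _; rewrite -s2.
rewrite -p1 -p2 -u1 -u2 sumrB !big_split/= -!mulr_sumr.
ring.
Qed.

End FieldEquations.

(** * The augmented field *)

Section BilinearAugmentation.
Variables (R : realType) (Phi : integrator R).
Hypothesis Phi_regular : regular_integrator Phi.
Hypothesis Phi_affine : affine_equivariant Phi.
Hypothesis Phi_quadratic : preserves_quadratic_invariants Phi.
Variables (Y Z : completeNormedModType R) (f : Y -> Y) (W0 : {bilinear Y -> Y -> Z}).
Hypothesis sf : smooth f.
Hypothesis W0_cont : continuous (fun a : Y * Y => W0 a.1 a.2).

(** The last component is the rate of change of [W0 xi eta] along the first three. Written without a
    divergence, the field is visibly smooth. *)
Definition bilinear_augmentation (w : Y * Y * Y * Z) : Y * Y * Y * Z :=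
  (f w.1.1.1, 'd f (w.1.1.1) (w.1.1.2), 'd f (w.1.1.1) (w.1.2),
   W0 ('d f (w.1.1.1) (w.1.1.2)) w.1.2 + W0 w.1.1.2 ('d f (w.1.1.1) (w.1.2))).

Let C1 k : Ck k setT (fun w : Y * Y * Y * Z => w.1.1.1).
Proof. exact: (Ck_comp (Ck_comp (Ck_fst k _ _) (Ck_fst k _ _)) (Ck_fst k _ _)). Qed.

Let C2 k : Ck k setT (fun w : Y * Y * Y * Z => w.1.1.2).
Proof. exact: (Ck_comp (Ck_comp (Ck_fst k _ _) (Ck_fst k _ _)) (Ck_snd k _ _)). Qed.

Let C3 k : Ck k setT (fun w : Y * Y * Y * Z => w.1.2).
Proof. exact: (Ck_comp (Ck_fst k _ _) (Ck_snd k _ _)). Qed.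

Lemma smooth_bilinear_augmentation : smooth bilinear_augmentation.
Proof.
move=> k.
have cf2 := Ck_comp (Ck_pair (@C1 k) (@C2 k)) (smooth_tangent sf k).
have cf3 := Ck_comp (Ck_pair (@C1 k) (@C3 k)) (smooth_tangent sf k).
have cW := Ck_bilin k W0_cont.
apply: Ck_pair.
  by apply: Ck_pair => //; apply: Ck_pair => //; exact: (Ck_comp (@C1 k) (sf k)).
apply: Ck_add.
  exact: (Ck_comp (Ck_pair cf2 (@C3 k)) cW).
exact: (Ck_comp (Ck_pair (@C2 k) cf3) cW).
Qed.

Definition defect (w : Y * Y * Y * Z) : Z := w.2 - W0 w.1.1.2 w.1.2.

Lemma defect_is_diff w :
  is_diff w defect
    (fun h => h.2 - (W0 w.1.1.2 h.1.2 + W0 h.1.1.2 w.1.2)).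
Proof.
have d2 : is_diff w (snd : Y * Y * Y * Z -> Z) snd.
  by apply: linear_is_diff => // ?; exact: cvg_snd.
have dp : is_diff w (fun w : Y * Y * Y * Z => (w.1.1.2, w.1.2))
    (fun w : Y * Y * Y * Z => (w.1.1.2, w.1.2)).
  by apply: linear_is_diff => //; apply/Ck0/Ck_pair; [exact: C2|exact: C3].
have dW : is_diff (w.1.1.2, w.1.2) (fun a : Y * Y => W0 a.1 a.2)
    (fun a : Y * Y => W0 w.1.1.2 a.2 + W0 a.1 w.1.2).
  apply: DiffDef; first exact: differentiable_bilin.
  by rewrite diff_bilin.
exact: (is_diffB d2 (is_diff_comp dp dW)).
Qed.

Lemma quadratic_defect : quadratic_map defect.
Proof.
have bil : bilinear_for (GRing.Scale.Law.clone _ _ *:%R _)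
    (GRing.Scale.Law.clone _ _ *:%R _)
    (fun a b : Y * Y * Y * Z => - W0 a.1.1.2 b.1.2).
  split=> [u'|u] c x y /=; first by rewrite linearPl opprD scalerN.
  by rewrite linearPr opprD scalerN.
pose Q : {bilinear Y * Y * Y * Z -> Y * Y * Y * Z -> Z} := HB.pack
  (fun a b : Y * Y * Y * Z => - W0 a.1.1.2 b.1.2)
  (bilinear_isBilinear.Build R _ _ _ _ _ _ bil).
exists 0, snd, Q; split.
- by move=> w; exact: cvg_snd.
- move=> p; apply: cvgN.
  have CW : Ck 0 setT (fun p : (Y * Y * Y * Z) * (Y * Y * Y * Z) =>
      W0 p.1.1.1.2 p.2.1.2).
    exact: (Ck_comp (Ck_pair (Ck_comp (Ck_fst 0 _ _) (@C2 0))
      (Ck_comp (Ck_snd 0 _ _) (@C3 0))) (Ck_bilin 0 W0_cont)).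
  by move/Ck0: CW; exact.
- by move=> w; rewrite add0r.
Qed.

(** The linear projections to [(y, xi)] and [(y, eta)] relate the field to [tangent_field f], which
    settles three components; invariance of [defect] settles the last. *)
Lemma bilinear_augmentationE y xi eta :
  Phi bilinear_augmentation (y, xi, eta, W0 xi eta) =
  (Phi f y, 'd (Phi f) y xi, 'd (Phi f) y eta,
   W0 ('d (Phi f) y xi) ('d (Phi f) y eta)).
Proof.
have sg := smooth_bilinear_augmentation.
set w := (y, xi, eta, _); set w' := Phi _ w.
have T (p : Y * Y * Y * Z -> Y) : linear p -> continuous p ->
    (forall w, p (bilinear_augmentation w) = 'd f (w.1.1.1) (p w)) ->
    (w'.1.1.1, p w') = (Phi f y, 'd (Phi f) y (p w)).
  move=> lp cp pE; pose L w := (w.1.1.1, p w).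
  have := @affine_equivariant_linear _ _ Phi_affine _ _ L 0
    bilinear_augmentation (tangent_field f) w.
  rewrite !addr0 -[L w]/(y, p w) tangent_fieldE// => -> //.
  - by move=> a u v; rewrite /L lp.
  - by apply: continuous_pair => //; apply/Ck0; exact: C1.
  - exact: smooth_tangent_field.
  - by move=> v; rewrite addr0 /L pE.
have [e1 e2] : (w'.1.1.1, w'.1.1.2) = (Phi f y, 'd (Phi f) y xi).
  by apply: (T (fun w => w.1.1.2)) => //; apply/Ck0; exact: C2.
have [_ e3] : (w'.1.1.1, w'.1.2) = (Phi f y, 'd (Phi f) y eta).
  by apply: (T (fun w => w.1.2)) => //; apply/Ck0; exact: C3.
have e4 : defect w' = defect w.
  apply: (Phi_quadratic sg quadratic_defect) => v.
  rewrite (@diff_val _ _ _ _ _ _ _ (defect_is_diff v)) /=.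
  by rewrite [X in X - _]addrC subrr.
(* [defect] vanishes at the initial state, hence also after the step. *)
move: e4; rewrite /defect subrr e2 e3 => /eqP; rewrite subr_eq0 => /eqP e4.
rewrite [LHS]surjective_pairing [w'.1]surjective_pairing [w'.1.1]surjective_pairing.
by rewrite e1 e2 e3 e4.
Qed.

End BilinearAugmentation.

Theorem theorem4p4 (R : realType) (m n : nat)
  (Omega : set 'rV[R]_m) (Omega_open : open Omega)
  (H : 'rV[R]_m -> phase R m n -> R) (dom : 'rV[R]_m -> set (phase R m n))
  (dom_open : forall x, Omega x -> open (dom x))
  (H_C2 : forall x, Omega x -> Ck 2 (dom x) (H x))
  (Y S Z : completeNormedModType R)
  (evY : Y -> 'rV[R]_m -> ('rV[R]_n * 'rV[R]_n)%type)
  (evS : S -> 'rV[R]_m -> 'M[R]_(n, m))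
  (evZ : Z -> 'rV[R]_m -> R)
  (Y_space : function_space Omega evY)
  (S_space : function_space Omega evS)
  (Z_space : function_space Omega evZ)
  (Y_cont : continuous_evaluation Omega evY)
  (S_cont : continuous_evaluation Omega evS)
  (Y_deriv : forall (y : Y) x (i : 'I_n) (mu : 'I_m), Omega x ->
     derivable (fun x' => (evY y x').1 0 i) x (delta_mx 0 mu))
  (S_deriv : forall (s : S) x (i : 'I_n) (mu : 'I_m), Omega x ->
     derivable (fun x' => evS s x' i mu) x (delta_mx 0 mu))
  (shat : 'rV[R]_m -> 'rV[R]_n -> 'rV[R]_n -> 'M[R]_(n, m) -> 'M[R]_(n, m))
  (sigma : Y -> S) (sigma_diff : forall y, differentiable sigma y)
  (sigma_implicit : implicit_sigma Omega H dom evY evS shat sigma)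
  (f : Y -> Y) (f_smooth : smooth f)
  (f_dDW : written_as_ode Omega H dom evY evS f sigma)
  (W0 : {bilinear Y -> Y -> Z})
  (W0_cont : continuous (fun a : Y * Y => W0 a.1 a.2))
  (W0_omega0 : density_omega0 Omega evY evS evZ sigma W0)
  (g : Y * Y * Y * Z -> Y * Y * Y * Z)
  (g_aug : augmented_field Omega evY evS evZ f sigma g)
  (Phi : integrator R)
  (Phi_regular : regular_integrator Phi)
  (Phi_affine : affine_equivariant Phi)
  (Phi_quadratic : preserves_quadratic_invariants Phi)
  (y0 xi0 eta0 : Y) :
  let y1 := Phi Y f y0 in
  let xi1 := 'd (Phi Y f) y0 xi0 in
  let eta1 := 'd (Phi Y f) y0 eta0 in
  Phi (Y * Y * Y * Z)%type g (y0, xi0, eta0, W0 xi0 eta0)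
  = (y1, xi1, eta1, W0 xi1 eta1).
Proof.
have lZ x (Ox : Omega x) a b c : evZ (a *: b + c) x = a * evZ b x + evZ c x.
  exact: (Z_space.1 x Ox).
(* An element of [Z] is determined by its values on [Omega], so the pointwise conservation law
   identifies the two fields; smoothness of [g] comes with this. *)
have gE : g = bilinear_augmentation f W0.
  apply/funext => -[[[y xi] eta] z].
  have [g1 g2] := g_aug y xi eta z.
  rewrite [LHS]surjective_pairing g1; congr pair.
  apply: Z_space.2 => x Ox; rewrite g2//= -[X in evZ (X + _)]scale1r lZ// mul1r.
  rewrite !(W0_omega0 y)//; apply/esym.
  exact: (multisymplectic_conservation Omega_open dom_open H_C2 Y_space S_space
    Y_cont S_cont Y_deriv S_deriv sigma_diff
    (fun y => smooth_differentiable y f_smooth) f_dDW).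
by rewrite /= gE; exact: bilinear_augmentationE.
Qed.
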